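(* There is an algorithm which, given an irreducible graph $G=(V,E)$ with $n$ vertices, diameter $\mathrm{diam}(G)=2$ and minimum degree $\delta$, decides whether $G$ admits a proper $3$-coloring in time $2^{O(\min\{\delta,\ \frac{n}{\delta}\log\delta\})}$.
   Context: Graphs are finite, simple and undirected. For a vertex $u$, $N(u)$ is its set of neighbors and $N[u]=N(u)\cup\{u\}$. A proper $3$-coloring assigns one of three colors to each vertex so that adjacent vertices receive different colors. The diamond is the graph on $4$ vertices with $5$ edges ($K_4$ minus one edge). A graph $G$ is called irreducible if it contains no $K_4$ as an induced subgraph, contains no induced diamond, and has no two distinct vertices $u,v$ with $N(u)\subseteq N(v)$.
   Formalization: The time bound carries an extra polynomial factor: n^k · 2^{c·min{δ, (n/δ) log δ}} for fixed constants c and k, since without it the bound would demand constant time on arbitrarily large irreducible diameter-2 graphs with δ = 2. *)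

(* Defs.v *)
From mathcomp Require Import all_boot all_order all_algebra.
From mathcomp Require Import all_classical all_reals all_analysis.

Set Implicit Arguments.
Unset Strict Implicit.
Unset Printing Implicit Defensive.

Local Open Scope nat_scope.

Record graph (V : finType) := Graph {
  edge :> rel V;
  edge_sym : symmetric edge;
  edge_irrefl : irreflexive edge }.

Definition nbhd (V : finType) (G : graph V) (u : V) : {set V} :=
  [set v | G u v].

(* The default [#|V|] exceeds every degree, so it is only the value on the
   graph without vertices. *)
Definition min_degree (V : finType) (G : graph V) : nat :=
  \big[minn/#|V|]_(v : V) #|nbhd G v|.

Definition walk (V : finType) (G : graph V) (u v : V) (k : nat) : Prop :=
  exists p : seq V, [/\ path G u p, last u p = v & size p = k].

Definition is_dist (V : finType) (G : graph V) (u v : V) (k : nat) : Prop :=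
  walk G u v k /\ forall l, walk G u v l -> k <= l.

(* [d] is the maximum of the distances; no [d] qualifies when [G] is
   disconnected (infinite diameter) or has no vertices. *)
Definition is_diam (V : finType) (G : graph V) (d : nat) : Prop :=
  (forall u v, exists2 k, is_dist G u v k & k <= d) /\
  (exists u v, is_dist G u v d).

Definition has_induced (W V : finType) (H : graph W) (G : graph V) : Prop :=
  exists f : W -> V, injective f /\ forall x y, G (f x) (f y) = H x y.

Definition K4_rel : rel 'I_4 := fun x y => x != y.

Lemma K4_sym : symmetric K4_rel.
Proof. by move=> x y; rewrite /K4_rel eq_sym. Qed.

Lemma K4_irrefl : irreflexive K4_rel.
Proof. by move=> x; rewrite /K4_rel eqxx. Qed.

Definition K4 : graph 'I_4 := Graph K4_sym K4_irrefl.

(* The missing edge is {0, 1}. *)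
Definition diamond_rel : rel 'I_4 :=
  fun x y => (x != y) && ~~ ((x < 2) && (y < 2)).

Lemma diamond_sym : symmetric diamond_rel.
Proof. by move=> x y; rewrite /diamond_rel eq_sym andbC [(x < 2) && _]andbC andbC. Qed.

Lemma diamond_irrefl : irreflexive diamond_rel.
Proof. by move=> x; rewrite /diamond_rel eqxx. Qed.

Definition diamond : graph 'I_4 := Graph diamond_sym diamond_irrefl.

Definition irreducible (V : finType) (G : graph V) : Prop :=
  [/\ ~ has_induced K4 G,
      ~ has_induced diamond G
    & forall u v, u != v -> ~ (nbhd G u \subset nbhd G v)].

Definition three_colorable (V : finType) (G : graph V) : Prop :=
  exists col : V -> 'I_3, forall u v, G u v -> col u != col v.

(* Algorithms are programs of a unit-cost random access machine: finitely many
   registers (those a program mentions), a memory with indirect addressing, and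
   the arithmetic operations [+] and truncated [-] only.  Without
   multiplication, numbers grow by at most one bit per time unit, so running times
   agree with those of Turing machines up to a polynomial. *)
Inductive expr :=
| Const of nat
| Reg of nat
| Read of expr
| Add of expr & expr
| Sub of expr & expr.

Inductive prog :=
| Skip
| Assign of nat & expr
| Write of expr & expr
| Seq of prog & prog
| IfNZ of expr & prog & prog
| WhileNZ of expr & prog.

Record state := State { reg : nat -> nat; mem : nat -> nat }.

Definition upd (f : nat -> nat) (a v : nat) : nat -> nat :=
  fun b => if b == a then v else f b.

Fixpoint eval (s : state) (e : expr) : nat :=
  match e with
  | Const k => k
  | Reg x => reg s x
  | Read a => mem s (eval s a)
  | Add a b => eval s a + eval s b
  | Sub a b => eval s a - eval s b
  end.

Fixpoint cost (e : expr) : nat :=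
  match e with
  | Const _ | Reg _ => 1
  | Read a => (cost a).+1
  | Add a b | Sub a b => (cost a + cost b).+1
  end.

(* [exec p s t s']: started in state [s], [p] halts in state [s'] after exactly
   [t] time units. *)
Inductive exec : prog -> state -> nat -> state -> Prop :=
| ExecSkip s : exec Skip s 1 s
| ExecAssign s x e :
    exec (Assign x e) s (cost e).+1 (State (upd (reg s) x (eval s e)) (mem s))
| ExecWrite s a e :
    exec (Write a e) s (cost a + cost e).+1
         (State (reg s) (upd (mem s) (eval s a) (eval s e)))
| ExecSeq p q s s1 s2 t1 t2 :
    exec p s t1 s1 -> exec q s1 t2 s2 -> exec (Seq p q) s (t1 + t2) s2
| ExecIfTrue e p q s s1 t :
    eval s e != 0 -> exec p s t s1 -> exec (IfNZ e p q) s (cost e + t).+1 s1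
| ExecIfFalse e p q s s1 t :
    eval s e = 0 -> exec q s t s1 -> exec (IfNZ e p q) s (cost e + t).+1 s1
| ExecWhileTrue e p s s1 s2 t1 t2 :
    eval s e != 0 -> exec p s t1 s1 -> exec (WhileNZ e p) s1 t2 s2 ->
    exec (WhileNZ e p) s (cost e + t1 + t2).+1 s2
| ExecWhileFalse e p s :
    eval s e = 0 -> exec (WhileNZ e p) s (cost e).+1 s.

(* The input is [n] in register 0 and the adjacency matrix, row by row, in
   memory cells 0, ..., n * n - 1; everything else is 0. *)
Definition input (n : nat) (G : graph 'I_n) : state :=
  State (fun x => if x == 0 then n else 0)
        (fun a => [exists i : 'I_n, [exists j : 'I_n,
                     (a == i * n + j) && G i j]] : nat).

(* The answer is read off register 0: nonzero means yes. *)
Definition decides_within (R : realType) (p : prog) (s : state) (P : Prop)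
    (T : R) : Prop :=
  exists t s', [/\ exec p s t s', reg s' 0 != 0 <-> P & (t%:R <= T)%R].

(* Main.v *)
(** A set [D] such that every vertex outside [D] has a neighbor in [D] reduces
    3-colorability to [3 ^ #|D|] instances of list coloring with lists of size
    at most 2. Such an instance is solvable iff for every vertex [v] some color
    of [v] propagates without contradiction: the partial colorings so obtained
    can be glued, because a vertex [x] that is still open after a propagation
    has lost exactly one color, the one lost to its neighbor in [D], so that
    every neighbor colored by that propagation has this very color, which is
    excluded at [x] by all other propagations as well.
    In diameter 2 the neighborhood of any vertex is such a set, which bounds
    [#|D|] by the minimum degree [d]. The greedy algorithm leaves at most
    [n (1 - d / n) ^ j] vertices uncovered after [j] steps, and taking [j] close
    to [(n / d) ln d] gives a set of size [O((n / d) ln d)]; the algorithm uses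
    the smaller of the two sets. *)
Require Import Defs.
From mathcomp Require Import all_boot all_order all_algebra.
From mathcomp Require Import all_classical all_reals all_analysis.
From mathcomp Require Import zify ring lra.
(* Several names of [Defs] ([mem], [eval], [Sub]) are shadowed above. *)
Import Defs.

Set Implicit Arguments.
Unset Strict Implicit.
Unset Printing Implicit Defensive.

Local Open Scope nat_scope.

(** * A structured language for the random access machine *)

(* [HA k x] reads array [k] at the index held by register [x]; [HE x y] tests
   the adjacency of the vertices held by [x] and [y]. Loops always run [n]
   times, so the running time of a command is polynomial by construction. *)
Inductive hexpr :=
| HC of nat
| HR of nat
| HN
| HA of nat & nat
| HE of nat & nat
| HAdd of hexpr & hexpr
| HSub of hexpr & hexpr.

Inductive cmd :=
| CSkip
| CSet of nat & hexpr
| CPut of nat & nat & hexpr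
| CSeq of cmd & cmd
| CIf of hexpr & cmd & cmd
| CFor of nat & cmd.

Record hst := HState { rg : nat -> nat; ar : nat -> nat -> nat }.

Definition setr (h : hst) (x v : nat) : hst := HState (upd (rg h) x v) (ar h).

Definition seta (h : hst) (k i v : nat) : hst :=
  HState (rg h) (fun l => if l == k then upd (ar h k) i v else ar h l).

Lemma setr_setr h x v w : setr (setr h x v) x w = setr h x w.
Proof.
by congr HState; apply/boolp.funext => y; rewrite /= /upd; case: eqP.
Qed.

Lemma setr_id h x : setr h x (rg h x) = h.
Proof.
by case: h => r a; congr HState; apply/boolp.funext => y; rewrite /= /upd; case: eqP => // ->.
Qed.

Fixpoint loop (f : hst -> hst) (x i k : nat) (h : hst) : hst :=
  if k is k'.+1 then loop f x i.+1 k' (f (setr h x i)) else setr h x i.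

Lemma loop_setr f x i k h v : loop f x i k (setr h x v) = loop f x i k h.
Proof. by case: k => [|k] /=; rewrite setr_setr. Qed.

Section Denotation.

Variables (n : nat) (E : nat -> nat -> bool).

Fixpoint heval (h : hst) (e : hexpr) : nat :=
  match e with
  | HC k => k
  | HR x => rg h x
  | HN => n
  | HA k x => ar h k (rg h x)
  | HE x y => E (rg h x) (rg h y)
  | HAdd a b => heval h a + heval h b
  | HSub a b => heval h a - heval h b
  end.

Fixpoint den (c : cmd) (h : hst) : hst :=
  match c with
  | CSkip => h
  | CSet x e => setr h x (heval h e)
  | CPut k x e => seta h k (rg h x) (heval h e)
  | CSeq a b => den b (den a h)
  | CIf e a b => if heval h e != 0 then den a h else den b h
  | CFor x b => loop (den b) x 0 n h
  end.

(** The invariant speaks of the state before the counter is stored; the exit state then differs from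
    one satisfying [I n] only in the counter, which holds [n]. *)
Lemma for_inv (I : nat -> hst -> Prop) x b h :
  I 0 h ->
  (forall i h', i < n -> I i h' -> I i.+1 (den b (setr h' x i))) ->
  exists2 h', I n h' & den (CFor x b) h = setr h' x n.
Proof.
move=> I0 IS /=.
have: forall k i h', i + k = n -> I i h' ->
    exists2 h'', I n h'' & loop (den b) x i k h' = setr h'' x n.
  elim=> [|k IH] i h' ik Ih /=.
    by move: ik Ih; rewrite addn0 => ->; exists h'.
  by apply: IH; [lia | apply: IS => //; lia].
by apply.
Qed.

End Denotation.

(** * Frame conditions: registers and arrays that a command leaves alone *)

Fixpoint assigned (c : cmd) : seq nat :=
  match c with
  | CSkip | CPut _ _ _ => [::]
  | CSet x _ => [:: x]
  | CSeq a b | CIf _ a b => assigned a ++ assigned b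
  | CFor x b => x :: assigned b
  end.

Fixpoint written (c : cmd) : seq nat :=
  match c with
  | CSkip | CSet _ _ => [::]
  | CPut k _ _ => [:: k]
  | CSeq a b | CIf _ a b => written a ++ written b
  | CFor _ b => written b
  end.

Lemma frame_rg n E c h x : x \notin assigned c -> rg (den n E c h) x = rg h x.
Proof.
elim: c h => [|y e|k y e|a IHa b IHb|e a IHa b IHb|y b IHb] h //=.
- by rewrite inE /upd => /negbTE ->.
- by rewrite mem_cat negb_or => /andP[xa xb]; rewrite IHb // IHa.
- by rewrite mem_cat negb_or => /andP[xa xb]; case: ifP => _; [apply: IHa|apply: IHb].
- rewrite inE negb_or => /andP[xy xb].
  have: forall k i h, rg (loop (den n E b) y i k h) x = rg h x; last by apply.
  elim=> [|k IH] i {}h /=.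
    by rewrite /upd (negbTE xy).
  by rewrite IH // IHb // /= /upd (negbTE xy).
Qed.

Lemma frame_ar n E c h k : k \notin written c -> ar (den n E c h) k = ar h k.
Proof.
elim: c h => [|y e|l y e|a IHa b IHb|e a IHa b IHb|y b IHb] h //=.
- by rewrite inE => /negbTE ->.
- by rewrite mem_cat negb_or => /andP[xa xb]; rewrite IHb // IHa.
- by rewrite mem_cat negb_or => /andP[xa xb]; case: ifP => _; [apply: IHa|apply: IHb].
- move=> kb; have: forall m i h, ar (loop (den n E b) y i m h) k = ar h k; last by apply.
  by elim=> [|m IH] i {}h //=; rewrite IH // IHb.
Qed.

(** * Compilation to the machine and its simulation *)

Definition oct (e : expr) : expr :=
  let d e := Add e e in d (d (d e)).

(** Register 1 holds [n * n], the first address above the input matrix. Interleaving with stride 8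
    leaves every array unbounded. *)
Definition cell (k : nat) (e : expr) : expr :=
  Add (Reg 1) (Add (oct e) (Const k)).

(* Truncating indices to [n - 1] keeps adjacency reads inside the input matrix
   whatever the registers hold, so that [den] can be total. *)
Definition clamp (x : nat) : expr :=
  Sub (Reg x.+2) (Sub (Reg x.+2) (Sub (Reg 0) (Const 1))).

Fixpoint cexpr (e : hexpr) : expr :=
  match e with
  | HC k => Const k
  | HR x => Reg x.+2
  | HN => Reg 0
  | HA k x => Read (cell k (Reg x.+2))
  | HE x y => Read (Add (Read (cell 7 (clamp x))) (clamp y))
  | HAdd a b => Add (cexpr a) (cexpr b)
  | HSub a b => Sub (cexpr a) (cexpr b)
  end.

Fixpoint comp (c : cmd) : prog :=
  match c with
  | CSkip => Skip
  | CSet x e => Assign x.+2 (cexpr e)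
  | CPut k x e => Write (cell k (Reg x.+2)) (cexpr e)
  | CSeq a b => Seq (comp a) (comp b)
  | CIf e a b => IfNZ (cexpr e) (comp a) (comp b)
  | CFor x b =>
      Seq (Assign x.+2 (Const 0))
          (WhileNZ (Sub (Reg 0) (Reg x.+2))
             (Seq (comp b) (Assign x.+2 (Add (Reg x.+2) (Const 1)))))
  end.

Fixpoint wfe (e : hexpr) : bool :=
  match e with
  | HA k _ => k < 7
  | HAdd a b | HSub a b => wfe a && wfe b
  | _ => true
  end.

Fixpoint wf (c : cmd) : bool :=
  match c with
  | CSkip => true
  | CSet _ e => wfe e
  | CPut k _ e => (k < 7) && wfe e
  | CSeq a b => wf a && wf b
  | CIf e a b => [&& wfe e, wf a & wf b]
  | CFor x b => (x \notin assigned b) && wf b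
  end.

(** An exponent rather than a cost: the time will be at most [n ^ deg c]. For [2 <= n], one further
    power of [n] absorbs the factor 2 of a sum, and six absorb the [n] rounds of a loop with their
    overhead. *)
Fixpoint deg (c : cmd) : nat :=
  match c with
  | CSkip => 0
  | CSet _ e => (cost (cexpr e)).+1
  | CPut k x e => (cost (cell k (Reg x.+2)) + cost (cexpr e)).+1
  | CSeq a b => (deg a + deg b).+1
  | CIf e a b => (cost (cexpr e) + deg a + deg b).+2
  | CFor _ b => deg b + 6
  end.

(** The truncation is that of [clamp], so that the denotation agrees with the compiled read on all
    register contents and not only on vertices. *)
Definition adj (n : nat) (G : graph 'I_n) (x y : nat) : bool :=
  mem (input G) (minn x n.-1 * n + minn y n.-1) != 0.

Lemma mem_input n (G : graph 'I_n) (i j : 'I_n) : mem (input G) (i * n + j) = G i j.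
Proof.
rewrite /=; case: (boolP (G i j)) => Gij.
  suff -> : [exists i' : 'I_n, [exists j' : 'I_n, (i * n + j == i' * n + j') && G i' j']] by [].
  by apply/existsP; exists i; apply/existsP; exists j; rewrite eqxx.
apply/eqP; rewrite eqb0; apply: contra Gij.
case/existsP=> i' /existsP[j' /andP[/eqP e Gij]].
have n0 : 0 < n by case: (n) i {i' j' Gij e} => [[]|].
have ei : i = i'.
  by apply: val_inj; move: (congr1 (divn^~ n) e); rewrite /= !divnMDl // !divn_small // !addn0.
have ej : j = j' by apply: val_inj; move: e; rewrite ei => /addnI.
by rewrite ei ej.
Qed.

Lemma adjE n (G : graph 'I_n) (i j : 'I_n) : adj G i j = G i j.
Proof.
have m (k : 'I_n) : minn k n.-1 = k by have := ltn_ord k; lia.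
by rewrite /adj !m mem_input eqb0 negbK.
Qed.

Lemma clamp_lt n (x : nat) : 2 <= n -> minn x n.-1 < n.
Proof. lia. Qed.

(* Above the input matrix, memory is split into 8 interleaved arrays; the last
   one tabulates the row offsets [i * n], the machine having no
   multiplication. *)
Record sim (n : nat) (G : graph 'I_n) (s : state) (h : hst) : Prop := Sim {
  sim_n : reg s 0 = n;
  sim_sq : reg s 1 = n * n;
  sim_rg : forall x, reg s x.+2 = rg h x;
  sim_ar : forall k i, k < 7 -> mem s (n * n + (8 * i + k)) = ar h k i;
  sim_row : forall i, i < n -> mem s (n * n + (8 * i + 7)) = i * n;
  sim_adj : forall a, a < n * n -> mem s a = mem (input G) a }.

Section Simulation.

Variables (n : nat) (G : graph 'I_n).
Hypothesis n_ge2 : 2 <= n.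

Lemma eval_clamp s h x : sim G s h -> eval s (clamp x) = minn (rg h x) n.-1.
Proof. by move=> S; rewrite /= (sim_rg S) (sim_n S); lia. Qed.

Lemma eval_cell s h k e : sim G s h -> eval s (cell k e) = n * n + (8 * eval s e + k).
Proof. by move=> S; rewrite /cell /= (sim_sq S); lia. Qed.

Lemma cexprP s h e : sim G s h -> wfe e -> eval s (cexpr e) = heval n (adj G) h e.
Proof.
move=> S; elim: e => [k|x||k x|x y|a IHa b IHb|a IHa b IHb].
- by [].
- by move=> _; apply: (sim_rg S).
- by move=> _; apply: (sim_n S).
- move=> /= k7; rewrite (sim_sq S) -(sim_ar S) //= (sim_rg S); congr mem; lia.
- move=> _; rewrite -[LHS]/(mem s (mem s (eval s (cell 7 (clamp x))) + eval s (clamp y))).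
  rewrite (eval_cell _ _ S) !(eval_clamp _ S) /= (sim_row S); last exact: clamp_lt.
  have hx := clamp_lt (rg h x) n_ge2; have hy := clamp_lt (rg h y) n_ge2.
  rewrite (sim_adj S); last by nia.
  have /= := mem_input G (Ordinal hx) (Ordinal hy).
  by rewrite /adj => e; rewrite /= e eqb0 negbK.
- by move=> /= /andP[/IHa -> /IHb ->].
- by move=> /= /andP[/IHa -> /IHb ->].
Qed.

Lemma sim_setr s h x v :
  sim G s h -> sim G (State (upd (reg s) x.+2 v) (mem s)) (setr h x v).
Proof.
case=> S1 S2 S3 S4 S5 S6; split=> //= y; rewrite /upd.
by rewrite eqSS eqSS; case: eqP.
Qed.

Lemma sim_seta s h k i v : k < 7 ->
  sim G s h -> sim G (State (reg s) (upd (mem s) (n * n + (8 * i + k)) v)) (seta h k i v).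
Proof.
move=> k7 [S1 S2 S3 S4 S5 S6]; split=> //=.
- move=> l j l7; rewrite /upd eqn_add2l; case: (l =P k) => [->|lk].
    rewrite eqn_add2r eqn_pmul2l //; case: eqP => // _; exact: S4.
  by case: eqP => [e|_]; [exfalso; lia | apply: S4].
- by move=> j jn; rewrite /upd; case: eqP => [e|_]; [exfalso; lia | apply: S5].
- by move=> a an; rewrite /upd; case: eqP => [e|_]; [exfalso; lia | apply: S6].
Qed.

Lemma cost_le k : k <= n ^ k.
Proof. by apply: leq_trans (ltnW (ltn_expl k n_ge2)) _. Qed.

Lemma pow_gt0 k : 0 < n ^ k.
Proof. by rewrite expn_gt0; lia. Qed.

Lemma pow_leq a b : a <= b -> n ^ a <= n ^ b.
Proof. by move=> ab; rewrite leq_pexp2l //; lia. Qed.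

(** By [wf] no loop body assigns its own counter, so the compiled while loop runs exactly [n] times
    and stays in step with [loop]. *)
Lemma compP c s h : wf c -> sim G s h ->
  exists t s', [/\ exec (comp c) s t s', t <= n ^ deg c & sim G s' (den n (adj G) c h)].
Proof.
elim: c s h => [|x e|k x e|a IHa b IHb|e a IHa b IHb|x b IHb] s h.
- by move=> _ S; exists 1, s; split=> //; exact: ExecSkip.
- move=> W S; eexists _, _; split; [exact: ExecAssign| exact: cost_le|].
  by rewrite (cexprP S W); apply: sim_setr.
- move=> /= /andP[k7 W] S; eexists _, _; split; [exact: ExecWrite| exact: cost_le|].
  rewrite (cexprP S W) (eval_cell _ _ S) /= (sim_rg S); exact: sim_seta.
- move=> /= /andP[Wa Wb] S; have [t1 [s1 [e1 l1 S1]]] := IHa _ _ Wa S.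
  have [t2 [s2 [e2 l2 S2]]] := IHb _ _ Wb S1.
  exists (t1 + t2), s2; split=> //; first exact: ExecSeq e1 e2.
  have := @pow_leq (deg a) (deg a + deg b) (leq_addr _ _).
  have := @pow_leq (deg b) (deg a + deg b) (leq_addl _ _).
  by rewrite expnS; nia.
- move=> /= /and3P[We Wa Wb] S; rewrite -(cexprP S We).
  have B d : d <= deg a + deg b ->
     forall t, t <= n ^ d -> (cost (cexpr e) + t).+1 <= n ^ (cost (cexpr e) + deg a + deg b).+2.
    move=> dl t tl; rewrite -addnA.
    have := leq_trans (cost_le (cost (cexpr e))) (@pow_leq _ _ (leq_addr (deg a + deg b) _)).
    have := leq_trans tl (pow_leq (leq_trans dl (leq_addl (cost (cexpr e)) _))).
    have := pow_gt0 (cost (cexpr e) + (deg a + deg b)).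
    rewrite !expnS; set P := n ^ _.
    by have := leq_mul n_ge2 (leq_mul n_ge2 (leqnn P)); lia.
  case: eqP => [e0|/eqP e0] /=.
    have [t [s1 [e1 l1 S1]]] := IHb _ _ Wb S.
    exists (cost (cexpr e) + t).+1, s1; split=> //; first exact: ExecIfFalse.
    exact: (B _ (leq_addl _ _) _ l1).
  have [t [s1 [e1 l1 S1]]] := IHa _ _ Wa S.
  exists (cost (cexpr e) + t).+1, s1; split=> //; first exact: ExecIfTrue.
  exact: (B _ (leq_addr _ _) _ l1).
- move=> /= /andP[xb Wb] S.
  set W := WhileNZ _ _; set f := den n (adj G) b.
  (* With [k] rounds to go, each round pays 8 units for its test and increment, and the last failing
     test costs 4. *)
  have L k : forall i s h, i + k = n -> sim G s h -> rg h x = i ->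
      exists t s', [/\ exec W s t s', t <= k * (n ^ deg b + 8) + 4
                     & sim G s' (loop f x i k h)].
    elim: k => [|k IH] i {}s {}h ik {}S hx.
      exists 4, s; split=> //; first by apply: (@ExecWhileFalse (Sub _ _)); rewrite /= (sim_rg S) (sim_n S); lia.
      by rewrite /= -hx setr_id.
    have [t1 [s1 [e1 l1 S1]]] := IHb _ _ Wb S.
    have h1x : rg (f h) x = i by rewrite /f frame_rg.
    set s2 := State (upd (reg s1) x.+2 i.+1) (mem s1).
    have S2 : sim G s2 (setr (f h) x i.+1) by apply: sim_setr.
    have [|//|t3 [s3 [e3 l3 S3]]] := IH i.+1 s2 _ _ S2 _; first by lia.
      by rewrite /= /upd eqxx.
    exists (3 + (t1 + 4) + t3).+1, s3; split; last first.
    + have Eh : setr h x i = h by rewrite -hx setr_id.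
      by rewrite loop_setr in S3; rewrite /= Eh.
    + by rewrite mulSn; lia.
    + apply: (@ExecWhileTrue (Sub _ _)) e3; first by rewrite /= (sim_rg S) (sim_n S); lia.
      apply: ExecSeq e1 _; rewrite /s2.
      have -> : i.+1 = eval s1 (Add (Reg x.+2) (Const 1)).
        by rewrite /= (sim_rg S1) [rg _ _]h1x addn1.
      exact: (ExecAssign s1 x.+2 (Add (Reg x.+2) (Const 1))).
  have [|t [s1 [e1 l1 S1]]] := L n 0 _ _ (add0n n) (sim_setr x 0 S); first by rewrite /= /upd eqxx.
  rewrite loop_setr in S1.
  exists (2 + t), s1; split=> //; first by apply: ExecSeq e1; exact: (ExecAssign s x.+2 (Const 0)).
  rewrite expnD; have := pow_gt0 (deg b); have : n * 32 <= n ^ 6.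
    by rewrite expnS leq_mul2l (@leq_exp2r 2 n 5) // n_ge2 orbT.
  by nia.
Qed.

End Simulation.

(** * Countdown loops and initialization *)

Definition down (x : nat) (b : prog) : prog :=
  WhileNZ (Reg x) (Seq (Assign x (Sub (Reg x) (Const 1))) b).

(** Unlike [CFor], this loop may run exponentially often. It decrements before entering the body, so
    the body sees the values from the initial one minus 1 down to 0. *)
Lemma exec_down x b T (I : nat -> state -> Prop) :
  (forall m s, I m.+1 s -> reg s x = m.+1 ->
    exists t s', [/\ exec b (State (upd (reg s) x m) (mem s)) t s', t <= T,
                     reg s' x = m & I m s']) ->
  forall m s, I m s -> reg s x = m ->
    exists t s', [/\ exec (down x b) s t s', t <= m * (T + 6) + 2 & I 0 s'].
Proof.
move=> step; elim=> [|m IH] s Is sx.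
  exists 2, s; split=> //; exact: (@ExecWhileFalse (Reg x)).
have [t1 [s1 [e1 l1 x1 I1]]] := step _ _ Is sx.
have [t2 [s2 [e2 l2 I2]]] := IH _ I1 x1.
exists (1 + (4 + t1) + t2).+1, s2; split=> //; last by rewrite mulSn; lia.
apply: (@ExecWhileTrue (Reg x)) e2; first by rewrite /= sx.
apply: ExecSeq e1; rewrite (_ : m = eval s (Sub (Reg x) (Const 1))); first exact: ExecAssign.
by rewrite /= sx subn1.
Qed.

(** The first loop obtains [n * n] by repeated addition; the second fills the table of row offsets
    from the last row to the first by repeated subtraction. *)
Definition setup : prog :=
  Seq (Seq (Assign 2 (Reg 0)) (down 2 (Assign 1 (Add (Reg 1) (Reg 0)))))
      (Seq (Seq (Assign 2 (Reg 0)) (Assign 3 (Reg 1)))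
           (down 2 (Seq (Assign 3 (Sub (Reg 3) (Reg 0))) (Write (cell 7 (Reg 2)) (Reg 3))))).

Lemma setupP n (G : graph 'I_n) :
  exists t s h, [/\ exec setup (input G) t s, t <= n * 60 + 20 & sim G s h].
Proof.
pose I1 m s := [/\ reg s 0 = n, reg s 1 = (n - m) * n, m <= n & mem s = mem (input G)].
have [|||t1 [s1 [e1 l1 [a1 b1 _ c1]]]] := @exec_down 2 (Assign 1 (Add (Reg 1) (Reg 0))) 4 I1 _
    n (State (upd (reg (input G)) 2 n) (mem (input G))).
- move=> m s [s0 s1 mn sm] _; eexists _, _; split; first exact: ExecAssign.
  + by [].
  + by [].
  + split=> //=; [|by lia].
    by rewrite /upd /= s1 s0 -mulSnr; congr (_ * _); lia.
- by split=> //=; rewrite /upd /= subnn.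
- by [].
rewrite subn0 in b1.
pose I2 m s := [/\ reg s 0 = n /\ reg s 1 = n * n, reg s 3 = m * n, m <= n,
    (forall a, a < n * n -> mem s a = mem (input G) a)
  & forall i, m <= i < n -> mem s (n * n + (8 * i + 7)) = i * n].
have [|||t2 [s2 [e2 l2 [[a2 a2'] b2 _ c2 d2]]]] := @exec_down 2 (Seq (Assign 3 (Sub (Reg 3) (Reg 0))) (Write (cell 7 (Reg 2)) (Reg 3))) 40 I2 _
    n (State (upd (upd (reg s1) 2 n) 3 (n * n)) (mem s1)).
- move=> m s [[s0 sq] s3 mn sG sr] s2; eexists _, _; split.
  + by apply: ExecSeq; [exact: ExecAssign | exact: ExecWrite].
  + by [].
  + by [].
  + rewrite /= /upd /= s0 sq s3 mulSn addKn.
    split=> //=; [by lia| |].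
    * by move=> a an; case: eqP => [e|_]; [exfalso; lia | apply: sG].
    * move=> i /andP[mi ni]; case: eqP => [e|ne].
        by congr (_ * _); lia.
      by apply: sr; apply/andP; split=> //; lia.
- by split=> //=; [rewrite c1|move=> i; lia].
- by [].
exists (2 + t1 + ((2 + 2) + t2)), s2, (HState (fun x => reg s2 x.+2) (fun k i => mem s2 (n * n + (8 * i + k)))).
split.
- apply: ExecSeq.
    apply: ExecSeq e1; exact: (ExecAssign (input G) 2 (Reg 0)).
  apply: ExecSeq e2; apply: ExecSeq.
    exact: (ExecAssign s1 2 (Reg 0)).
  rewrite /= a1 -b1; exact: (ExecAssign (State (upd (reg s1) 2 n) (mem s1)) 3 (Reg 1)).
- by lia.
- by split=> //= i ni; apply: d2.
Qed.

Definition search (pre body : cmd) (M ans : nat) : prog :=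
  Seq setup (Seq (comp pre) (Seq (down M.+2 (comp body)) (Assign 0 (Reg ans.+2)))).

(** [J m] is the invariant when [m] candidates remain. The condition on [pre] ranges over all [h]
    because the initialization leaves arbitrary values in the simulated registers and arrays. *)
Lemma searchP pre body M ans n (G : graph 'I_n) (Q : Prop)
    (J : nat -> hst -> Prop) :
  2 <= n -> wf pre -> wf body -> M \notin assigned body ->
  (forall h, let h' := den n (adj G) pre h in J (rg h' M) h') ->
  (forall m h, J m.+1 h -> rg h M = m.+1 -> J m (den n (adj G) body (setr h M m))) ->
  (forall h, J 0 h -> (rg h ans != 0 <-> Q)) ->
  exists t s' h, [/\ exec (search pre body M ans) (input G) t s',
     reg s' 0 != 0 <-> Q & t <= n ^ (deg pre + deg body + 10) * (rg (den n (adj G) pre h) M).+1].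
Proof.
move=> n2 Wp Wb Mb pres bods fin.
have [t0 [s0 [h0 [e0 l0 S0]]]] := setupP G.
have [t1 [s1 [e1 l1 S1]]] := compP n2 Wp S0.
have := pres h0; set h1 := den _ _ _ _ in S1 * => J1.
pose I m s := exists2 h, sim G s h & J m h.
have step m s : I m.+1 s -> reg s M.+2 = m.+1 ->
    exists t s', [/\ exec (comp body) (State (upd (reg s) M.+2 m) (mem s)) t s', t <= n ^ deg body,
                     reg s' M.+2 = m & I m s'].
  move=> [h S Jh] sM.
  have [t [s' [e l S']]] := compP n2 Wb (sim_setr M m S).
  exists t, s'; split=> //.
    by rewrite (sim_rg S') frame_rg //= /upd eqxx.
  exists (den n (adj G) body (setr h M m)) => //; apply: bods => //; by rewrite -(sim_rg S).
have [||t2 [s2 [e2 l2 [h2 S2 J2]]]] := exec_down step (m := rg h1 M) (s := s1).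
- by exists h1.
- by rewrite (sim_rg S1).
exists (t0 + (t1 + (t2 + 2))), (State (upd (reg s2) 0 (reg s2 ans.+2)) (mem s2)), h0; split.
- by apply: ExecSeq e0 _; apply: ExecSeq e1 _; apply: ExecSeq e2 _; exact: (ExecAssign s2 0 (Reg ans.+2)).
- by rewrite /upd /= (sim_rg S2); apply: fin.
(* The factor [128 * n] covers initialization and loop overhead; ten additional powers of [n] pay
   for it since [2 <= n]. *)
have A : n * 128 * (n ^ deg pre * n ^ deg body) <= n ^ (deg pre + deg body + 10).
  rewrite [_ + 10]addnC !expnD leq_pmul2r ?muln_gt0 ?pow_gt0 //.
  have : n * (2 ^ 9) <= n ^ 10 by rewrite (expnS n 9) leq_mul2l (@leq_exp2r 2 n 9) // n2 orbT.
  by lia.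
apply: leq_trans (leq_mul A (leqnn _)).
have := pow_gt0 n2 (deg pre); have := pow_gt0 n2 (deg body).
move: (n ^ deg pre) (n ^ deg body) l1 l2 => a b l1 l2 b0 a0.
rewrite -/h1; set N := rg h1 M in l2 *.
have ab : a <= a * b /\ b <= a * b by nia.
have : N * (b + 6) <= N * (7 * (a * b)) by rewrite leq_mul2l; apply/orP; right; lia.
have : 0 < a * b by rewrite muln_gt0 a0.
move: (a * b) ab => c [ac bc] c0.
have : n * 128 * c * N.+1 = 128 * (n * c) * N + 128 * (n * c) by lia.
have : c * 2 <= n * c by rewrite mulnC leq_mul2r n2 orbT.
have : n <= n * c by rewrite leq_pmulr.
move: (n * c) => d nd cd -> X; nia.
Qed.

(** * Gluing propagations *)

Lemma third_color (a b : 'I_3) : a != b ->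
  exists c : 'I_3, forall e, e != c -> e = a \/ e = b.
Proof.
(* The three colors sum to 3, so the remaining one is [3 - a - b]. *)
move=> ab; have c3 : 3 - a - b < 3 by move: ab; rewrite -val_eqE /=; lia.
exists (Ordinal c3) => e; rewrite -val_eqE /= => ec.
have [ae|ae] := eqVneq e a; first by left.
right; apply: val_inj; move: ab ec ae; rewrite -!val_eqE /=.
by have := ltn_ord a; have := ltn_ord b; have := ltn_ord e; lia.
Qed.

Section Propagation.

Variables (V : finType) (G : graph V).

(** Here [B w e] means that color [e] is ruled out at [w]. The color [c] itself may be ruled out
    too; that contradiction is left to [consistent]. *)
Definition decides (B : V -> 'I_3 -> bool) (w : V) (c : 'I_3) : Prop :=
  forall e, e != c -> B w e.

Definition closed_forb (B : V -> 'I_3 -> bool) : Prop :=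
  forall w x d, G w x -> decides B w d -> B x d.

Definition consistent (B : V -> 'I_3 -> bool) : Prop :=
  forall w, exists d, ~~ B w d.

Definition dominating (D : pred V) : Prop :=
  forall x, D x \/ exists2 y, D y & G y x.

(** Used for completeness: a proper coloring, read as a system of forbidden colors, is closed under
    propagation, as the only color it can decide at [w] is [f w]. *)
Lemma proper_closed (f : V -> 'I_3) :
  (forall u v, G u v -> f u != f v) -> closed_forb (fun w e => e != f w).
Proof.
move=> fP w x d wx dw; have [->|dfw] := eqVneq d (f w); first exact: fP.
by have := dw (f w); rewrite eqxx eq_sym => /(_ dfw).
Qed.

End Propagation.

(* Each vertex [w] takes its color from the first propagation deciding it. *)
Lemma extend_coloring n (G : graph 'I_n) (D : pred 'I_n) (col : 'I_n -> 'I_3) :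
  dominating G D ->
  (forall v, exists B, [/\ closed_forb G B, consistent B,
     forall y, D y -> decides B y (col y) & exists c, decides B v c]) ->
  three_colorable G.
Proof.
move=> dom /boolp.choice[B HB].
pose dec v w := [exists c, [forall e, (e != c) ==> B v w e]].
have decP v w c : decides (B v) w c -> dec v w.
  by move=> H; apply/existsP; exists c; apply/forallP => e; apply/implyP/H.
have decw w : dec w w by have [_ _ _ [c]] := HB w; apply: decP.
pose first w := [arg min_(v < w | dec v w) (v : nat)].
have firstP w : dec (first w) w /\ forall v, dec v w -> first w <= v.
  by rewrite /first; case: arg_minnP.
have /boolp.choice[f fP] : forall w, exists c, decides (B (first w)) w c.
  move=> w; have [/existsP[c /forallP H] _] := firstP w.
  by exists c => e; apply/implyP.
have fN w : ~~ B (first w) w (f w).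
  have [_ cons _ _] := HB (first w); have [d dN] := cons w.
  by have [<-//|/(fP w)] := eqVneq d (f w); rewrite (negbTE dN).
exists f.
(* By symmetry, the propagation chosen for [w] may be assumed to come no later than that of [x]. *)
suff main w x : G w x -> first w <= first x -> f w != f x.
  move=> w x wx; case: (leqP (first w) (first x)) => [/main|/ltnW/main H]; first exact.
  by rewrite eq_sym; apply: H; rewrite edge_sym.
move=> wx le; have [cl cons ini _] := HB (first w).
have Bx : B (first w) x (f w) by apply: cl wx (fP w).
case: (boolP (dec (first w) x)) => [dx|ndx].
  (* If the propagation of [w] also decides [x], minimality makes both vertices use it, and its
     consistency separates their colors. *)
  have e : first w = first x by apply/val_inj/anti_leq; rewrite le (proj2 (firstP x)).
  by apply/eqP => ef; move: Bx; rewrite ef e (negbTE (fN x)).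
(* Otherwise [x] is still open there, hence outside [D], and has lost the color of a neighbor [y] in
   [D]. *)
case: (dom x) => [Dx|[y Dy yx]]; first by rewrite (decP _ _ _ (ini _ Dx)) in ndx.
have By : B (first w) x (col y) by apply: cl yx (ini _ Dy).
(* If [f w] differed from [col y], two colors would be lost at [x], which would then be decided. *)
have [efy|/third_color[c cP]] := eqVneq (f w) (col y); last first.
  by case/negP: ndx; apply: (decP _ _ c) => e /cP[] ->.
(* So [f w] is the color of [y], which the propagation chosen for [x] excludes at [x] as well. *)
have [clx _ inix _] := HB (first x).
have := clx _ _ _ yx (inix _ Dy); rewrite -efy.
by apply: contraTneq => ->; exact: fN.
Qed.

(** Double counting of the pairs of adjacent vertices whose first member lies in [U]. *)
Lemma greedy_gain (V : finType) (G : graph V) (U : {set V}) (d b : nat) :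
  (forall u, d <= #|nbhd G u|) -> (forall v, #|nbhd G v :&: U| <= b) ->
  #|U| * d <= #|V| * b.
Proof.
move=> dP bP; rewrite -!sum_nat_const.
apply: (@leq_trans (\sum_(v : V) #|nbhd G v :&: U|)); last exact: leq_sum.
apply: (@leq_trans (\sum_(u in U) #|nbhd G u|)); first exact: leq_sum.
under eq_bigr do rewrite -sum1_card.
under [X in _ <= X]eq_bigr do rewrite -sum1_card.
rewrite (exchange_big_dep predT) //=.
apply: leq_sum => v _; rewrite (eq_bigl [in nbhd G v :&: U]) // => u.
by rewrite !inE edge_sym andbC.
Qed.

(** * Minimum degree and diameter 2 *)

Lemma min_degree_le (V : finType) (G : graph V) v : min_degree G <= #|nbhd G v|.
Proof.
rewrite /min_degree; have: v \in index_enum V by rewrite mem_index_enum.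
elim: (index_enum V) => // u s IH; rewrite inE big_cons geq_min.
by case/orP=> [/eqP <-|/IH ->]; rewrite ?leqnn ?orbT.
Qed.

Lemma min_degree_ge (V : finType) (G : graph V) d :
  d <= #|V| -> (forall v, d <= #|nbhd G v|) -> d <= min_degree G.
Proof.
move=> dV H; rewrite /min_degree; elim/big_ind: _ => // x y dx dy.
by rewrite leq_min dx.
Qed.

Lemma min_degree_attained (V : finType) (G : graph V) :
  0 < #|V| -> exists v, #|nbhd G v| <= min_degree G.
Proof.
case/card_gt0P=> v0 _; apply: contrapT => /forallNP H.
have : (min_degree G).+1 <= min_degree G; last by rewrite ltnn.
apply: min_degree_ge.
  by apply: leq_trans (max_card [in nbhd G v0]); rewrite ltnNge; apply/negP/H.
by move=> v; rewrite ltnNge; apply/negP/H.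
Qed.

Lemma diam2_card (V : finType) (G : graph V) : is_diam G 2 -> 2 < #|V|.
Proof.
case=> _ [u [v [[p [pp lp sp]] min]]].
case: p pp lp sp => [|x [|y []]] //= /and3P[ux xy _] yv _.
move: xy; rewrite yv => xv.
have uv : u != v.
  apply/eqP => uv; have: 2 <= 0; last by [].
  by apply: min; exists [::]; rewrite uv.
have ne a b : G a b -> a != b by apply: contraTneq => ->; rewrite edge_irrefl.
have /card_uniqP e : uniq [:: u; x; v] by rewrite /= !inE negb_or (ne _ _ ux) uv (ne _ _ xv).
by rewrite -[3]/(size [:: u; x; v]) -e max_card.
Qed.

Lemma diam2_walk (V : finType) (G : graph V) u v : is_diam G 2 -> u != v ->
  G u v \/ exists2 x, G u x & G x v.
Proof.
case=> H _ uv; have [k [[p [pp lp sp]] _] k2] := H u v.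
case: p pp lp sp => [_ /= e|x [|y [|z p]]] /=.
- by rewrite e eqxx in uv.
- by rewrite andbT => ux <- _; left.
- by move=> /and3P[ux xy _] <- _; right; exists x.
- by move=> _ _ kE; rewrite -kE in k2.
Qed.

(** An isolated vertex has its empty neighborhood inside any other. If [v] has the single neighbor
    [w], a third vertex [u] is reached from [v] through [w], so the neighborhood of [v] lies in that
    of [u]. *)
Lemma irreducible_min_degree (V : finType) (G : graph V) :
  irreducible G -> is_diam G 2 -> 2 <= min_degree G.
Proof.
move=> [_ _ irr] diam; have V3 := diam2_card diam.
apply: min_degree_ge => [|v]; first exact: ltnW.
rewrite leqNgt; apply/negP; rewrite ltnS leq_eqVlt ltnS leqn0 orbC.
have ex (s : seq V) : size s <= 2 -> exists u, u \notin s.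
  move=> s2; apply: contrapT => /forallNP H.
  have : #|V| <= size s; last by lia.
  apply: leq_trans (card_size s); apply: subset_leq_card; apply/fintype.subsetP => u _.
  by apply/negPn/negP/H.
case/orP=> [/eqP/cards0_eq N0|/cards1P[w Nw]].
  have [u] := ex [:: v] isT; rewrite inE eq_sym => vu.
  by apply: (irr v u vu); rewrite N0 finset.sub0set.
have [u] := ex [:: v; w] isT; rewrite !inE negb_or => /andP[uv uw].
have vN x : G v x = (x == w) by have := Nw; move/setP/(_ x); rewrite !inE.
have [|vu|[x vx xu]] := diam2_walk (u := v) (v := u) diam; first by rewrite eq_sym.
  by rewrite -vN vu in uw.
apply: (irr v u); first by rewrite eq_sym.
apply/fintype.subsetP => y; rewrite !inE vN => /eqP ->.
by rewrite edge_sym; move: vx; rewrite vN => /eqP <-.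
Qed.

(** * The propagation program *)

(* Array [aD] flags the dominating set, [aCol] its coloring, [aU] the vertices
   not yet covered, and array [3 + e] the vertices at which color [e] is
   forbidden. *)
Local Notation rV := 0 (only parsing).
Local Notation rC := 1 (only parsing).
Local Notation rW := 2 (only parsing).
Local Notation rX := 3 (only parsing).
Local Notation rI := 4 (only parsing).
Local Notation rJ := 5 (only parsing).
Local Notation rBest := 6 (only parsing).
Local Notation rArg := 7 (only parsing).
Local Notation rSize := 8 (only parsing).
Local Notation rM := 9 (only parsing).
Local Notation rAns := 10 (only parsing).
Local Notation rRest := 11 (only parsing).
Local Notation rGood := 12 (only parsing).
Local Notation rOk := 13 (only parsing).
Local Notation rBad := 14 (only parsing).
Local Notation aD := 0 (only parsing).
Local Notation aPow := 1 (only parsing).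
Local Notation aCol := 2 (only parsing).
Local Notation aU := 6 (only parsing).
Local Notation "a ;; b" := (CSeq a b) (at level 61, right associativity).

Definition CWhen (e : hexpr) (c : cmd) : cmd := CIf e c CSkip.

(** With truncated subtraction this is the minimum, nonzero iff both values are. *)
Definition HAnd (a b : hexpr) : hexpr := HSub a (HSub a b).

(* Nonzero iff [e] differs from the color [c], where numbers above 2 stand for
   the color 2; a loop over [0, ..., n - 1] can thus range over the colors. *)
Definition excl (e : nat) (c : hexpr) : hexpr :=
  match e with
  | 0 => c
  | 1 => HAdd (HSub c (HC 1)) (HSub (HC 1) c)
  | _ => HSub (HC 2) c
  end.

Definition clear_at (e : nat) : cmd := CPut (3 + e) rW (HC 0).

(** Adding, instead of overwriting, preserves a mark that is already there. *)
Definition fix_at (r e : nat) (c : hexpr) : cmd :=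
  CPut (3 + e) r (HAdd (HA (3 + e) r) (excl e c)).

Definition start : cmd :=
  CFor rW (clear_at 0 ;; clear_at 1 ;; clear_at 2 ;;
           CWhen (HA aD rW)
             (fix_at rW 0 (HA aCol rW) ;; fix_at rW 1 (HA aCol rW) ;; fix_at rW 2 (HA aCol rW))) ;;
  fix_at rV 0 (HR rC) ;; fix_at rV 1 (HR rC) ;; fix_at rV 2 (HR rC).

(** The residues of [d + 1] and [d + 2] modulo 3 are the two colors other than [d]. *)
Definition rule (d : nat) : cmd :=
  CWhen (HAnd (HA (3 + d.+1 %% 3) rW) (HA (3 + d.+2 %% 3) rW)) (CPut (3 + d) rX (HC 1)).

Definition pass : cmd :=
  CFor rW (CFor rX (CWhen (HE rW rX) (rule 0 ;; rule 1 ;; rule 2))).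

Definition check : cmd :=
  CSet rBad (HC 0) ;;
  CFor rW (CWhen (HAnd (HA 3 rW) (HAnd (HA 4 rW) (HA 5 rW))) (CSet rBad (HC 1))).

Definition try : cmd := start ;; CFor rI (CFor rJ pass) ;; check.

Definition test_vertex : cmd :=
  CSet rOk (HC 0) ;; CFor rC (try ;; CIf (HR rBad) CSkip (CSet rOk (HC 1))).

Definition test_all : cmd :=
  CSet rGood (HC 1) ;;
  CFor rV (test_vertex ;; CIf (HR rOk) CSkip (CSet rGood (HC 0))).

(** * Correctness of the propagation program *)

Section PropagationProgram.

Variables (n : nat) (G : graph 'I_n).

Local Notation run := (den n (adj G)).

Lemma run_seq a b h : run (a ;; b) h = run b (run a h).
Proof. by []. Qed.

Lemma run_when e c h : run (CWhen e c) h = if heval n (adj G) h e != 0 then run c h else h.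
Proof. by []. Qed.

Lemma heval_and h a b : (heval n (adj G) h (HAnd a b) != 0) =
  (heval n (adj G) h a != 0) && (heval n (adj G) h b != 0).
Proof. by rewrite /=; lia. Qed.

Lemma excl_neq0 h e c : e < 3 ->
  (heval n (adj G) h (excl e c) != 0) = (e != minn (heval n (adj G) h c) 2).
Proof. by case: e => [|[|[|//]]] _ /=; lia. Qed.

Definition forb (h : hst) (w : 'I_n) (e : 'I_3) : bool := ar h (3 + e) w != 0.

Definition inD (h : hst) (w : 'I_n) : bool := ar h aD w != 0.

(** Only a contradiction-free propagation is required, not an extension to a proper coloring; gluing
    bridges that gap. *)
Definition satisfiable (D : pred 'I_n) (col : 'I_n -> 'I_3) (v : 'I_n) (c : 'I_3) :=
  exists B, [/\ closed_forb G B, consistent B,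
                forall y, D y -> decides B y (col y) & decides B v c].

(** The second half is soundness: new marks are forced by old ones. Together with closedness of the
    final marks it makes them the least closed system above the initial ones. *)
Definition derives (h h' : hst) : Prop :=
  (forall w e, forb h w e -> forb h' w e) /\
  (forall C, closed_forb G C -> (forall w e, forb h w e -> C w e) ->
     forall w e, forb h' w e -> C w e).

Lemma derives_refl h : derives h h.
Proof. by split. Qed.

Lemma derives_trans h1 h2 h3 : derives h1 h2 -> derives h2 h3 -> derives h1 h3.
Proof.
move=> [a1 b1] [a2 b2]; split=> [w e /a1/a2 //|C cC sub w e].
by apply: b2 => // u d; apply: b1.
Qed.

Lemma ruleP h (w x : 'I_n) (d : 'I_3) : rg h rW = w -> rg h rX = x -> G w x ->
  derives h (run (rule d) h) /\ (decides (forb h) w d -> forb (run (rule d) h) x d).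
Proof.
move=> hw hx wx; have d3 := ltn_ord d.
have m1 : d.+1 %% 3 < 3 by rewrite ltn_mod.
have m2 : d.+2 %% 3 < 3 by rewrite ltn_mod.
have decE : (heval n (adj G) h (HAnd (HA (3 + d.+1 %% 3) rW) (HA (3 + d.+2 %% 3) rW)) != 0)
   <-> decides (forb h) w d.
  rewrite heval_and /= hw; split=> [/andP[b1 b2] e ed|H].
    have: e = Ordinal m1 \/ e = Ordinal m2; last by case=> ->; [exact: b1|exact: b2].
    have := ltn_ord e; move: ed; rewrite -val_eqE /= => ed e3.
    by case: (eqVneq (e : nat) (d.+1 %% 3)) => ne; [left|right]; apply: val_inj => //=; lia.
  by apply/andP; split; [apply: (H (Ordinal m1))|apply: (H (Ordinal m2))]; rewrite -val_eqE /=; lia.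
rewrite /rule run_when; case: ifPn => [/decE H|/negP N].
  have F y e : forb (run (CPut (3 + d) rX (HC 1)) h) y e = ((y == x) && (e == d)) || forb h y e.
    rewrite /forb [in LHS]/= eqn_add2l val_eqE; case: (e =P d) => [->|_]; last by rewrite andbF.
    by rewrite /upd hx val_eqE andbT; case: (y == x).
  split=> [|_]; last by rewrite F !eqxx.
  split=> [y e ye|C cC sub y e]; first by rewrite F ye orbT.
  rewrite F; case/orP=> [/andP[/eqP -> /eqP ->]|]; last exact: sub.
  by apply: cC wx _ => a ad; apply/sub/H.
by split; [exact: derives_refl | move=> /decE H; case: N].
Qed.

Lemma decides_mono (B C : 'I_n -> 'I_3 -> bool) w d :
  (forall w e, B w e -> C w e) -> decides B w d -> decides C w d.
Proof. by move=> BC H e /H/BC. Qed.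

Lemma rulesP h (w x : 'I_n) : rg h rW = w -> rg h rX = x -> G w x ->
  let h' := run (rule 0 ;; rule 1 ;; rule 2) h in
  derives h h' /\ (forall d, decides (forb h) w d -> forb h' x d).
Proof.
move=> hw hx wx; rewrite !run_seq.
have [r0 d0] := @ruleP h w x (@Ordinal 3 0 isT) hw hx wx.
set h1 := run (rule 0) h in r0 d0 *.
have [||r1 d1] := @ruleP h1 w x (@Ordinal 3 1 isT) _ _ wx; try by rewrite frame_rg.
set h2 := run (rule 1) h1 in r1 d1 *.
have [||r2 d2] := @ruleP h2 w x (@Ordinal 3 2 isT) _ _ wx; try by rewrite !frame_rg.
set h3 := run (rule 2) h2 in r2 d2 *.
split; first exact: derives_trans (derives_trans r0 r1) r2.
move=> d H; have [s0 s1 s2] : [/\ (forall w e, forb h w e -> forb h1 w e),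
   (forall w e, forb h1 w e -> forb h2 w e) & (forall w e, forb h2 w e -> forb h3 w e)].
  by split; [case: r0|case: r1|case: r2].
case: d H => [[|[|[|//]]] p] H; rewrite (bool_irrelevance p isT) in H *.
- exact/s2/s1/d0.
- exact/s2/d1/(decides_mono s0).
- exact/d2/(decides_mono s1)/(decides_mono s0).
Qed.

(** Completeness is claimed only for vertices decided before the pass; marks added meanwhile do no
    harm, since marks only grow. *)
Lemma passP h : let h' := run pass h in
  derives h h' /\ (forall w x d, G w x -> decides (forb h) w d -> forb h' x d).
Proof.
pose I i h' := derives h h' /\
   (forall (w : 'I_n) x d, w < i -> G w x -> decides (forb h) w d -> forb h' x d).
have [||h1 [r1 c1]] := @for_inv n (adj G) I rW (CFor rX (CWhen (HE rW rX) (rule 0 ;; rule 1 ;; rule 2))) h;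
  last 1 first.
- by rewrite -/pass /= => ->; split=> // w x d; exact: c1.
- by split=> //; exact: derives_refl.
move=> i h1 ilt [r1 c1]; pose w := Ordinal ilt.
have: derives h1 (setr h1 rW i) by exact: derives_refl.
set h2 := setr h1 rW i => r2.
pose K j h' := [/\ derives h2 h', rg h' rW = i &
  forall (x : 'I_n) d, x < j -> G w x -> decides (forb h2) w d -> forb h' x d].
have [||h3 [r3 _ c3] ->] := @for_inv n (adj G) K rX (CWhen (HE rW rX) (rule 0 ;; rule 1 ;; rule 2)) h2.
- by split=> //; exact: derives_refl.
- move=> j h3 jlt [r3 h3w c3]; pose x := Ordinal jlt.
  have r4 : derives h3 (setr h3 rX j) by exact: derives_refl.
  set h4 := setr h3 rX j in r4 *.
  rewrite run_when.
  have -> : heval n (adj G) h4 (HE rW rX) = G w x.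
    by rewrite /= /upd /= h3w -[X in adj G X _]/(nat_of_ord w) -[X in adj G _ X]/(nat_of_ord x) adjE.
  have r24 := derives_trans r3 r4.
  rewrite eqb0 negbK; case: ifPn => wx; last first.
    split=> // y d; rewrite ltnS leq_eqVlt => /orP[/eqP yj|yj]; last exact: c3.
    by rewrite (_ : y = x) ?(negbTE wx) //; apply: val_inj.
  have [||r5 c5] := @rulesP h4 w x _ _ wx; [by rewrite /= /upd | by rewrite /= /upd|].
  split; first exact: derives_trans r24 r5.
    by rewrite frame_rg.
  move=> y d; rewrite ltnS leq_eqVlt => /orP[/eqP yj|yj].
    rewrite (_ : y = x); last exact: val_inj.
    by move=> _ H; apply: c5; apply: decides_mono H; case: r24.
  by move=> wy H; apply: (proj1 r5); apply: c3.
- split; first exact: derives_trans r1 (derives_trans r2 r3).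
  move=> u x d; rewrite ltnS leq_eqVlt => /orP[/eqP ui|ui] ux H.
    have uw : u = w by exact: val_inj.
    rewrite uw in ux H; apply: (c3 x d _ ux) => //.
    by apply: decides_mono H; case: r1.
  by apply: (proj1 r3); apply: (c1 u).
Qed.

(* [n * n >= 3 * n] rounds suffice, as each round but the last ones forbids a
   new pair. *)
Lemma roundsP h : 3 <= n -> let h' := run (CFor rI (CFor rJ pass)) h in
  derives h h' /\ closed_forb G (forb h').
Proof.
move=> n3; pose S h := [set p : 'I_n * 'I_3 | forb h p.1 p.2].
pose J r h' := derives h h' /\ (closed_forb G (forb h') \/ r <= #|S h'|).
have step r h1 k : J r h1 -> J r.+1 (run pass (setr h1 rJ k)).
  rewrite /J; set h2 := run _ _ => -[r1 c1].
  have [[mono least] cons] : derives h1 h2 /\ (forall w x d, G w x -> decides (forb h1) w d -> forb h2 x d).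
    exact: (passP (setr h1 rJ k)).
  split; first by apply: derives_trans r1 _; split.
  have [cl|ncl] := boolp.pselect (closed_forb G (forb h1)).
    left=> w x d wx H; apply: mono; apply: (cl _ _ _ wx).
    by apply: decides_mono H => u e; exact: (least _ cl).
  right; case: c1 => [//|c1]; apply: leq_ltn_trans c1 _; rewrite ltnNge; apply/negP => le.
  have eS : S h1 = S h2.
    apply/eqP; rewrite eqEcard le andbT; apply/fintype.subsetP => -[w e].
    by rewrite !inE; exact: mono.
  apply: ncl => w x d wx H; have := cons _ _ _ wx H.
  by have /setP/(_ (x, d)) := eS; rewrite !inE /= => ->.
suff [r [//|H]] : J (n * n) (run (CFor rI (CFor rJ pass)) h).
  (* If all pairs are forbidden, closedness is trivial. Otherwise there are fewer than
     [3 * n <= n * n] of them, too few for growth in every round. *)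
  split=> //; case: (eqVneq (S (run (CFor rI (CFor rJ pass)) h)) [set: _]) => [e|ne].
    by move=> w x d _ _; have /setP/(_ (x, d)) := e; rewrite !inE.
  have : #|S (run (CFor rI (CFor rJ pass)) h)| < #|[set: 'I_n * 'I_3]|.
    by apply: proper_card; rewrite finset.properEneq ne finset.subsetT.
  rewrite cardsT card_prod !card_ord; move: #|S _| H => m; nia.
have [||h1 J1 ->] := @for_inv n (adj G) (fun i => J (i * n)) rI (CFor rJ pass) h.
- by split; [exact: derives_refl | right].
- move=> i h1 ilt J1.
  have [||h2 J2 ->] := @for_inv n (adj G) (fun j => J (i * n + j)) rJ pass (setr h1 rI i).
  + by rewrite addn0.
  + by move=> j h2 jlt J2; rewrite addnS; apply: step.
  + by rewrite mulSn addnC.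
- by [].
Qed.

Lemma fix_atP h r e c (w : 'I_n) (d : 'I_3) : e < 3 ->
  forb (run (fix_at r e c) h) w d =
  forb h w d || [&& d == e :> nat, w == rg h r :> nat & e != minn (heval n (adj G) h c) 2].
Proof.
move=> e3; rewrite /forb [in LHS]/= eqn_add2l; case: (d =P e :> nat) => [de|_]; last by rewrite orbF.
rewrite /upd de; case: (w =P rg h r :> nat) => [we|_]; last by rewrite orbF.
by rewrite /= addn_eq0 negb_and excl_neq0 // we.
Qed.

Lemma fix_allP h r c (w : 'I_n) (d : 'I_3) :
  (forall h', rg h' = rg h -> ar h' aCol = ar h aCol ->
     heval n (adj G) h' c = heval n (adj G) h c) ->
  forb (run (fix_at r 0 c ;; fix_at r 1 c ;; fix_at r 2 c) h) w d =
  forb h w d || (w == rg h r :> nat) && (d != minn (heval n (adj G) h c) 2 :> nat).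
Proof.
move=> Hc; rewrite !run_seq.
set h1 := run (fix_at r 0 c) h; set h2 := run (fix_at r 1 c) h1.
rewrite !fix_atP // (Hc h1) // (Hc h2) // -/h1.
have -> : rg h1 r = rg h r by []; have -> : rg h2 r = rg h r by [].
case: (forb h w d) => //=; case: (_ == rg h r); rewrite ?andbF //=.
by case: d => [[|[|[|//]]] p] /=; rewrite ?orbF.
Qed.

Lemma clear_allP h (w : 'I_n) (d : 'I_3) :
  forb (run (clear_at 0 ;; clear_at 1 ;; clear_at 2) h) w d =
  (w != rg h rW :> nat) && forb h w d.
Proof.
rewrite /forb; case: d => [[|[|[|//]]] p] /=; rewrite /upd; by case: (_ =P rg h _).
Qed.

Lemma startP h (v : 'I_n) (col : 'I_n -> 'I_3) (w : 'I_n) (d : 'I_3) :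
  rg h rV = v -> (forall y, inD h y -> ar h aCol y = col y) ->
  forb (run start h) w d =
  inD h w && (d != col w) || (w == v) && (d != minn (rg h rC) 2 :> nat).
Proof.
move=> hv hcol; rewrite /start run_seq.
set fx := CWhen _ _; set body := _ ;; (_ ;; (_ ;; fx)).
pose I i h' := [/\ ar h' aD = ar h aD, ar h' aCol = ar h aCol
  & forall (w : 'I_n) d, w < i -> forb h' w d = inD h w && (d != col w)].
have eV : rg (run (CFor rW body) h) rV = v by rewrite frame_rg.
have eC : rg (run (CFor rW body) h) rC = rg h rC by rewrite frame_rg.
rewrite fix_allP; last by move=> h' e _ /=; rewrite e.
rewrite /= -/(run (CFor rW body) h) eV eC val_eqE; congr (_ || _).
have [||h1 [_ _ c1] ->] := @for_inv n (adj G) I rW body h; first by [].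
  move=> i h1 ilt [d1 l1 c1]; pose u := Ordinal ilt.
  split; [by rewrite frame_ar | by rewrite frame_ar |].
  move=> x e; rewrite ltnS => xi.
  set h2 := setr h1 rW i.
  rewrite -[run body h2]/(run fx (run (clear_at 0 ;; clear_at 1 ;; clear_at 2) h2)).
  set h3 := run _ h2.
  have h3w : rg h3 rW = i by rewrite frame_rg.
  have E3 : forb h3 x e = (x != i :> nat) && forb h1 x e by rewrite clear_allP.
  have d3 : ar h3 aD = ar h aD by rewrite frame_ar.
  have l3 : ar h3 aCol = ar h aCol by rewrite frame_ar.
  have lt : x != i :> nat -> x < i by move=> xne; rewrite ltn_neqAle xne.
  rewrite /fx run_when.
  have -> : heval n (adj G) h3 (HA aD rW) = ar h aD i by rewrite -[LHS]/(ar h3 aD (rg h3 rW)) h3w d3.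
  case: ifPn => Di.
    rewrite fix_allP; last by move=> h' /= -> ->.
    have -> : heval n (adj G) h3 (HA aCol rW) = ar h aCol i by rewrite -[LHS]/(ar h3 aCol (rg h3 rW)) h3w l3.
    rewrite E3 h3w; case: (boolP (x == i :> nat)) => [/eqP xe|xne] /=.
      rewrite -xe in Di *; rewrite hcol // /inD Di /= -val_eqE.
      by congr (_ != _); have := ltn_ord (col x); rewrite /=; lia.
    by rewrite orbF; apply/c1/lt.
  rewrite E3; case: (boolP (x == i :> nat)) => [/eqP xe|xne] /=.
    by rewrite /inD xe (negbTE Di).
  exact/c1/lt.
exact: c1.
Qed.

Lemma checkP h : rg (run check h) rBad = 0 <-> consistent (forb h).
Proof.
rewrite /check run_seq.
set h0 := run (CSet rBad (HC 0)) h; set c := CWhen _ _.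
pose I i h' := ar h' = ar h /\
  (rg h' rBad = 0 <-> forall w : 'I_n, w < i -> exists d, ~~ forb h w d).
have [||h1 [_ c1] ->] := @for_inv n (adj G) I rW c h0.
- by split=> //; split.
- move=> i h1 ilt [a1 b1]; pose u := Ordinal ilt.
  set h2 := setr h1 rW i; rewrite /c run_when !heval_and.
  have hE k : heval n (adj G) h2 (HA k rW) = ar h k u by rewrite /= a1.
  rewrite !hE; case: ifPn => full.
    split=> //=; split=> // /(_ u (ltnSn _))[d].
    suff -> : forb h u d by [].
    by case/and3P: full => f0 f1 f2; case: d => [[|[|[|//]]] p]; [exact: f0|exact: f1|exact: f2].
  split=> //; rewrite b1; split=> [H w|H w wi]; last exact/H/ltnW.
  rewrite ltnS leq_eqVlt => /orP[/eqP wi|/H //].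
  have -> : w = u by exact: val_inj.
  move: full; rewrite !negb_and => /or3P[] f.
  + by exists (@Ordinal 3 0 isT).
  + by exists (@Ordinal 3 1 isT).
  + by exists (@Ordinal 3 2 isT).
- rewrite -[rg _ _]/(rg h1 rBad) c1; split=> [H w|H w _]; exact: H.
Qed.

(** The computed marks are least among closed systems: if consistent they are a witness themselves,
    and they inherit consistency from any witness containing them. *)
Lemma tryP h (v : 'I_n) (col : 'I_n -> 'I_3) : 3 <= n ->
  rg h rV = v -> (forall y, inD h y -> ar h aCol y = col y) ->
  rg (run try h) rBad = 0 <-> satisfiable (inD h) col v (inord (minn (rg h rC) 2)).
Proof.
move=> n3 hv hcol; rewrite /try !run_seq checkP.
set h1 := run start h.
have E1 w d := startP w d hv hcol; rewrite -/h1 in E1.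
have [[mono least]] := roundsP h1 n3; set h2 := run _ h1 => cl.
have val_c : (inord (minn (rg h rC) 2) : 'I_3) = minn (rg h rC) 2 :> nat by rewrite inordK; lia.
split=> [cons|[B [clB consB iniB decB]] w].
  exists (forb h2); split=> // [y Dy e ne|e ne]; apply: mono; rewrite E1.
    by rewrite Dy ne.
  by rewrite eqxx -val_c val_eqE ne orbT.
have [d Nd] := consB w; exists d; apply: contra Nd; apply: (least _ clB) => u e.
rewrite E1 => /orP[/andP[Du ne]|/andP[/eqP -> ne]]; first exact: iniB ne.
by apply: decB; rewrite -val_eqE /= val_c.
Qed.

Lemma test_vertexP h (v : 'I_n) (col : 'I_n -> 'I_3) : 3 <= n ->
  rg h rV = v -> (forall y, inD h y -> ar h aCol y = col y) ->
  rg (run test_vertex h) rOk != 0 <-> exists c, satisfiable (inD h) col v c.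
Proof.
move=> n3 hv hcol; rewrite /test_vertex run_seq.
set h0 := run _ h; set body := try ;; _.
pose I i h' := [/\ ar h' aD = ar h aD, ar h' aCol = ar h aCol, rg h' rV = v &
  (rg h' rOk != 0 <-> exists2 c, c < i & satisfiable (inD h) col v (inord (minn c 2)))].
have [||h1 [_ _ _ c1] ->] := @for_inv n (adj G) I rC body h0.
- by split=> //; split=> // -[].
- move=> i h1 ilt [d1 l1 v1 b1].
  split; [by rewrite frame_ar | by rewrite frame_ar | by rewrite frame_rg |].
  set h2 := setr h1 rC i.
  have D2 : inD h2 = inD h by rewrite /inD /= d1.
  have T : rg (run try h2) rBad = 0 <-> satisfiable (inD h) col v (inord (minn i 2)).
    by have := @tryP h2 v col n3 v1; rewrite D2 [ar h2 _]l1 => /(_ hcol).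
  rewrite -[run body h2]/(if rg (run try h2) rBad != 0 then run try h2 else setr (run try h2) rOk 1).
  have ok : rg (run try h2) rOk = rg h1 rOk by rewrite frame_rg.
  case: ifPn => [bad|/negPn/eqP good] /=.
    rewrite ok b1; split=> [[c ci sc]|[c]]; first by exists c => //; apply: ltnW.
    rewrite ltnS leq_eqVlt => /orP[/eqP ->|ci sc]; last by exists c.
    by move/T => b0; rewrite b0 in bad.
  by split=> // _; exists i => //; apply/T.
- rewrite -[rg _ _]/(rg h1 rOk) c1; split=> [[c _ sc]|[c sc]]; first by exists (inord (minn c 2)).
  exists c; first exact: leq_trans (ltn_ord c) n3.
  suff -> : inord (minn c 2) = c by [].
  by apply: val_inj; rewrite /= inordK; have := ltn_ord c; lia.
Qed.

Lemma test_allP h (col : 'I_n -> 'I_3) : 3 <= n ->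
  (forall y, inD h y -> ar h aCol y = col y) ->
  rg (run test_all h) rGood != 0 <-> forall v, exists c, satisfiable (inD h) col v c.
Proof.
move=> n3 hcol; rewrite /test_all run_seq.
set h0 := run _ h; set body := test_vertex ;; _.
pose I i h' := [/\ ar h' aD = ar h aD, ar h' aCol = ar h aCol &
  (rg h' rGood != 0 <-> forall v : 'I_n, v < i -> exists c, satisfiable (inD h) col v c)].
have [||h1 [_ _ c1] ->] := @for_inv n (adj G) I rV body h0.
- by split=> //; split.
- move=> i h1 ilt [d1 l1 b1]; pose v := Ordinal ilt.
  split; [by rewrite frame_ar | by rewrite frame_ar |].
  set h2 := setr h1 rV i.
  have D2 : inD h2 = inD h by rewrite /inD /= d1.
  have := @test_vertexP h2 v col n3 erefl; rewrite D2 [ar h2 _]l1 => /(_ hcol) T.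
  rewrite -[run body h2]/(if rg (run test_vertex h2) rOk != 0 then run test_vertex h2
    else setr (run test_vertex h2) rGood 0).
  have good : rg (run test_vertex h2) rGood = rg h1 rGood by rewrite frame_rg.
  case: ifPn => [ok|bad].
    rewrite good b1; split=> [H u|H u ui]; last exact/H/ltnW.
    rewrite ltnS leq_eqVlt => /orP[/eqP ui|/H //].
    by rewrite (_ : u = v); [apply/T | apply: val_inj].
  split=> // H; exfalso; move/negP: bad; apply; apply/T/H; exact: ltnSn.
- by rewrite -[rg _ _]/(rg h1 rGood) c1; split=> H v; [apply: H|move=> _; exact: H].
Qed.

End PropagationProgram.

(** * Enumerating colorings and choosing the dominating set *)

(* [rM] counts down from [3 ^ #|D|]; in its base 3 expansion, the digit of
   [v] has as many digits below it as there are elements of [D] below [v]. *)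
Definition powers : cmd :=
  CSet rM (HC 1) ;;
  CFor rV (CWhen (HA aD rV)
    (CPut aPow rV (HR rM) ;; CSet rM (HAdd (HR rM) (HAdd (HR rM) (HR rM))))).

(** Digits come off from the most significant one, hence the descending order of vertices. Adding 1
    before the truncated subtraction tests for at least rather than for greater. *)
Definition decode : cmd :=
  CSet rRest (HR rM) ;;
  CFor rI (CSet rV (HSub HN (HAdd (HR rI) (HC 1))) ;;
    CWhen (HA aD rV)
      (CIf (HSub (HAdd (HR rRest) (HC 1)) (HAdd (HA aPow rV) (HA aPow rV)))
         (CPut aCol rV (HC 2) ;; CSet rRest (HSub (HR rRest) (HAdd (HA aPow rV) (HA aPow rV))))
         (CIf (HSub (HAdd (HR rRest) (HC 1)) (HA aPow rV))
            (CPut aCol rV (HC 1) ;; CSet rRest (HSub (HR rRest) (HA aPow rV)))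
            (CPut aCol rV (HC 0))))).

Definition try_next : cmd :=
  decode ;; test_all ;; CWhen (HR rGood) (CSet rAns (HC 1)).

Definition count (e : hexpr) : cmd :=
  CSet rC (HC 0) ;; CFor rX (CWhen e (CSet rC (HAdd (HR rC) (HC 1)))).

Definition find_best : cmd :=
  CSet rBest (HC 0) ;;
  CFor rV (count (HAnd (HE rV rX) (HA aU rX)) ;;
    CWhen (HSub (HR rC) (HR rBest)) (CSet rBest (HR rC) ;; CSet rArg (HR rV))).

Definition cover : cmd := CFor rX (CWhen (HE rArg rX) (CPut aU rX (HC 0))).

Definition greedy_step : cmd :=
  find_best ;;
  CWhen (HR rBest)
    (CPut aD rArg (HC 1) ;; CSet rSize (HAdd (HR rSize) (HC 1)) ;; cover).

Definition greedy : cmd :=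
  CFor rX (CPut aD rX (HC 0) ;; CPut aU rX (HC 1)) ;; CSet rSize (HC 0) ;;
  CFor rI greedy_step.

Definition copy_row : cmd := CFor rX (CPut aD rX (HE rV rX)).

Definition smallest : cmd :=
  CFor rV (count (HE rV rX) ;;
    CWhen (HSub (HR rSize) (HR rC)) (CSet rSize (HR rC) ;; copy_row)).

Definition rank n (D : pred 'I_n) (i : nat) : nat := #|[set x : 'I_n | D x && (x < i)]|.

Lemma rankS n (D : pred 'I_n) (o : 'I_n) : rank D o.+1 = D o + rank D o.
Proof.
rewrite /rank; case: (boolP (D o)) => Do.
  rewrite (_ : [set x : 'I_n | D x && (x < o.+1)] = o |: [set x : 'I_n | D x && (x < o)]).
    by rewrite cardsU1 inE Do ltnn.
  apply/setP => x; rewrite !inE ltnS leq_eqVlt -val_eqE /=.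
  by case: eqP => [/val_inj ->|_] //=; rewrite Do.
congr #|pred_of_set _|; apply/setP => x; rewrite !inE ltnS leq_eqVlt.
by case: eqP => [/val_inj ->|_] //=; rewrite (negbTE Do).
Qed.

Lemma rank0 n (D : pred 'I_n) : rank D 0 = 0.
Proof. by apply: eq_card0 => x; rewrite !inE andbF. Qed.

Lemma rankn n (D : pred 'I_n) : rank D n = #|[set x | D x]|.
Proof. by apply: eq_card => x; rewrite !inE ltn_ord andbT. Qed.

(** The number whose base 3 digits are the colors of the members of [D] below [i], the smallest
    vertex being least significant. *)
Definition code n (D : pred 'I_n) (f : 'I_n -> 'I_3) (i : nat) : nat :=
  \sum_(x : 'I_n | D x && (x < i)) f x * 3 ^ rank D x.

Lemma codeS n (D : pred 'I_n) f (o : 'I_n) :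
  code D f o.+1 = D o * (f o * 3 ^ rank D o) + code D f o.
Proof.
rewrite /code; case: (boolP (D o)) => Do.
  rewrite (bigD1 o) ?Do ?ltnSn //= mul1n; congr (_ + _).
  apply: eq_bigl => x; rewrite ltnS ltn_neqAle -val_eqE /=.
  by rewrite -andbA [(x <= o) && _]andbC.
rewrite mul0n add0n; apply: eq_bigl => x; rewrite ltnS leq_eqVlt.
by case: eqP => [/val_inj ->|_] //=; rewrite (negbTE Do).
Qed.

Lemma code_lt n (D : pred 'I_n) f i : i <= n -> code D f i < 3 ^ rank D i.
Proof.
elim: i => [|i IH] ni; first by rewrite rank0 /code big_pred0 // => x; rewrite andbF.
have := IH (ltnW ni); rewrite -[i]/(nat_of_ord (Ordinal ni)) codeS rankS.
set o := Ordinal ni; case: (D o) => // lt; rewrite mul1n expnS.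
have := leq_mul (ltn_ord (f o)) (leqnn (3 ^ rank D o)).
by rewrite mulSn; lia.
Qed.

(** * Correctness of the enumeration *)

Section SearchProgram.

Variables (n : nat) (G : graph 'I_n).

Local Notation run := (den n (adj G)).
Local Notation inD := (@inD n).

Definition pow_table (h : hst) : Prop :=
  forall v : 'I_n, inD h v -> ar h aPow v = 3 ^ rank (inD h) v.

Lemma powersP h : let h' := run powers h in
  pow_table h' /\ rg h' rM = 3 ^ rank (inD h) n.
Proof.
rewrite /powers run_seq; set h0 := run _ h; set body := CWhen _ _.
pose I i h' := [/\ ar h' aD = ar h aD, rg h' rM = 3 ^ rank (inD h) i
  & forall v : 'I_n, v < i -> inD h v -> ar h' aPow v = 3 ^ rank (inD h) v].
have [||h1 [d1 m1 p1] ->] := @for_inv n (adj G) I rV body h0.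
- by split=> //; rewrite rank0.
- move=> i h1 ilt [d1 m1 p1]; pose o := Ordinal ilt.
  split; first by rewrite frame_ar.
    rewrite -[i]/(nat_of_ord o) rankS /body run_when.
    rewrite -[heval _ _ _ _]/(ar h1 aD o) d1 -/(inD h o).
    case: ifPn => Do; last by rewrite add0n.
    by rewrite /= /upd /= m1 expnS; lia.
  move=> v; rewrite /body run_when -[heval _ _ _ _]/(ar h1 aD o) d1 -/(inD h o).
  rewrite ltnS leq_eqVlt => /orP[/eqP vi|vi] Dv.
    have ov : o = v by apply: val_inj.
    have -> : inD h o by rewrite ov.
    by rewrite /= /upd vi eqxx m1 /= eqxx.
  case: ifPn => Do; last exact: p1.
  by rewrite /= /upd /= (ltn_eqF vi); apply: p1.
- have e : inD (setr h1 rV n) = inD h by apply/boolp.funext => v; rewrite /inD /= d1.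
  by split=> [v|]; rewrite ?e //; apply: p1.
Qed.

(** The first claim holds for every value of [rM] and makes whatever is decoded a coloring; the
    second serves completeness. *)
Lemma decodeP h : pow_table h -> let h' := run decode h in
  (forall v : 'I_n, inD h v -> ar h' aCol v < 3) /\
  (forall f, rg h rM = code (inD h) f n -> forall v : 'I_n, inD h v -> ar h' aCol v = f v).
Proof.
move=> pow; rewrite /decode run_seq; set h0 := run _ h; set body := _ ;; _.
pose I i h' := [/\ ar h' aD = ar h aD, ar h' aPow = ar h aPow,
  forall v : 'I_n, n - i <= v -> inD h v -> ar h' aCol v < 3 &
  forall f, rg h rM = code (inD h) f n -> rg h' rRest = code (inD h) f (n - i) /\
    forall v : 'I_n, n - i <= v -> inD h v -> ar h' aCol v = f v].
have [||h1 [d1 p1 c1 f1] ->] := @for_inv n (adj G) I rI body h0.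
- split=> //; first by move=> v; have := ltn_ord v; lia.
  by move=> f e; rewrite subn0; split=> // v; have := ltn_ord v; lia.
- move=> i h1 ilt [d1 p1 c1 f1].
  have olt : n - i.+1 < n by lia.
  pose o := Ordinal olt.
  have oS : n - i = o.+1 by rewrite /=; lia.
  rewrite /body run_seq; set h2 := run (CSet rV _) _.
  have h2o : rg h2 rV = o by rewrite /h2 /= /upd /= addn1.
  have h2r : rg h2 rRest = rg h1 rRest by [].
  have h2D : ar h2 aD = ar h aD by rewrite -d1.
  have h2P : ar h2 aPow = ar h aPow by rewrite -p1.
  have h2C : ar h2 aCol = ar h1 aCol by [].
  clearbody h2.
  rewrite run_when -[heval _ _ _ _]/(ar h2 aD (rg h2 rV)) h2D h2o -/(inD h o).
  have lt (v : 'I_n) : n - i.+1 <= v -> v = o \/ n - i <= v.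
    rewrite oS leq_eqVlt => /orP[/eqP e|]; last by right.
    by left; apply: val_inj.
  case: ifPn => Do; last first.
    split=> //.
    + by move=> v /lt[->|]; rewrite ?(negbTE Do) // h2C; apply: c1.
    + move=> f /f1[r1 e1]; split; first by rewrite h2r r1 oS codeS (negbTE Do).
      by move=> v /lt[->|]; rewrite ?(negbTE Do) // h2C; apply: e1.
  set P := 3 ^ rank (inD h) o.
  have hP : ar h2 aPow (rg h2 rV) = P by rewrite h2P h2o pow.
  (* Common to the three branches: storing [k] restores the invariant as soon as [k] is the leading
     digit and the rest has been reduced accordingly. *)
  have HC3 h3 k : ar h3 aD = ar h2 aD -> ar h3 aPow = ar h2 aPow ->
      ar h3 aCol = upd (ar h2 aCol) o k -> k < 3 ->
      (forall f : 'I_n -> 'I_3, rg h1 rRest = f o * P + code (inD h) f o -> k = f o /\ rg h3 rRest = code (inD h) f o) ->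
      I i.+1 h3.
    move=> e1 e2 e3 k3 ef; split; rewrite ?e1 ?e2 //.
      move=> v /lt[->|vi] Dv; rewrite e3 /upd; first by rewrite eqxx.
      by rewrite gtn_eqF 1?h2C; [apply: c1 | move: vi; rewrite oS].
    move=> f /[dup]/f1[r1 E1] E0.
    have [|kf r3] := ef f; first by rewrite r1 oS codeS Do mul1n.
    split=> // v /lt[->|vi] Dv; rewrite e3 /upd; first by rewrite eqxx.
    by rewrite gtn_eqF 1?h2C; [apply: E1 | move: vi; rewrite oS].
  have P0 : 0 < P by rewrite expn_gt0.
  have C f : code (inD h) f o < P by apply: code_lt; apply: ltnW.
  have F (f : 'I_n -> 'I_3) : [\/ f o = 0 :> nat, f o = 1 :> nat | f o = 2 :> nat].
    by case: (f o) => [[|[|[|//]]] p]; [constructor 1|constructor 2|constructor 3].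
  rewrite [run (CIf _ _ _) _]/= hP h2r.
  case: ifPn => c2.
    apply: (HC3 _ 2) => //=; first by rewrite /= h2o.
    move=> f; rewrite /upd /=; have /= Cf := C f.
    by case: (F f) => -> e; lia.
  case: ifPn => c3.
    apply: (HC3 _ 1) => //=; first by rewrite /= h2o.
    move=> f; rewrite /upd /=; have /= Cf := C f.
    by case: (F f) => -> e; lia.
  apply: (HC3 _ 0) => //=; first by rewrite /= h2o.
  move=> f; rewrite /=; have /= Cf := C f.
  by case: (F f) => -> e; lia.
- by split=> [v Dv|f /f1[_ H] v Dv]; [apply: c1|apply: H]; rewrite // subnn.
Qed.

(** Soundness is the gluing of propagations. Conversely, when the code of a proper coloring comes
    up, that coloring is a witness at every vertex. *)
Lemma try_nextP h : 3 <= n -> dominating G (inD h) -> pow_table h ->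
  let h' := run try_next h in
  [/\ rg h' rAns != 0 -> rg h rAns != 0 \/ three_colorable G,
      rg h rAns != 0 -> rg h' rAns != 0 &
      forall f, (forall u v, G u v -> f u != f v) -> rg h rM = code (inD h) f n ->
        rg h' rAns != 0].
Proof.
move=> n3 dom pow; have [lt dec] := decodeP pow.
rewrite /try_next !run_seq; set h1 := run decode h in lt dec *.
have D1 : inD h1 = inD h by apply/boolp.funext => v; rewrite /inD frame_ar.
have T col := @test_allP n G h1 col n3; rewrite D1 in T.
have A : rg (run test_all h1) rAns = rg h rAns by rewrite !frame_rg.
rewrite run_when -[heval _ _ _ _]/(rg (run test_all h1) rGood).
case: ifPn => good; split.
- move=> _; right; apply: (extend_coloring dom (col := fun v => inord (ar h1 aCol v))).
  have colE y : inD h y -> ar h1 aCol y = (inord (ar h1 aCol y) : 'I_3) by move=> /lt y3; rewrite inordK.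
  move=> v; have [c [B [a b i d]]] := proj1 (T _ colE) good v.
  by exists B; split=> //; exists c.
- by [].
- by [].
- by rewrite A; left.
- by rewrite A.
- move=> f fP /dec fE; case/negP: good; apply/(T f fE) => v; exists (f v).
  exists (fun w e => e != f w); split=> [||y _ //|//]; first exact: proper_closed.
  by move=> w; exists (f w); rewrite eqxx.
Qed.

Lemma setr_comm h x y v w : x != y -> setr (setr h x v) y w = setr (setr h y w) x v.
Proof.
move=> xy; congr HState; apply/boolp.funext => z; rewrite /= /upd.
by case: eqP => // ->; rewrite eq_sym (negbTE xy).
Qed.

(** Quantifying over [k] says that the counted test does not depend on the running count. *)
Lemma countP e (P : pred 'I_n) h :
  (forall (x : 'I_n) k, (heval n (adj G) (setr (setr h rC k) rX x) e != 0) = P x) ->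
  run (count e) h = setr (setr h rC #|[set x | P x]|) rX n.
Proof.
move=> eP; rewrite /count run_seq; set h0 := run _ h; set body := CWhen _ _.
pose I i h' := exists k, h' = setr (setr h rC (rank P i)) rX k.
have [||h1 [k ->] ->] := @for_inv n (adj G) I rX body h0.
- exists (rg h rX); rewrite rank0 -[LHS]/(setr h rC 0) -{1}(setr_id h rX).
  exact: setr_comm.
- move=> i h1 ilt [k ->]; pose o := Ordinal ilt; exists i.
  rewrite setr_setr /body run_when.
  rewrite -[X in setr _ rX X]/(nat_of_ord o) eP -[i]/(nat_of_ord o) rankS.
  case: ifPn => Po; last by [].
  rewrite [run _ _]/= [X in setr _ _ X]/= (setr_comm _ _ _ (isT : rX != rC)) setr_setr.
  by rewrite /upd /= addn1.
- by rewrite setr_setr rankn.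
Qed.

(** * Greedy covering and comparison with the neighborhoods *)

Definition Uset (h : hst) : {set 'I_n} := [set x : 'I_n | ar h aU x != 0].

Definition Dset (h : hst) : {set 'I_n} := [set x : 'I_n | inD h x].

Lemma find_bestP h : let h' := run find_best h in
  (forall v, #|nbhd G v :&: Uset h| <= rg h' rBest) /\
  (rg h' rBest != 0 -> exists2 v : 'I_n, rg h' rArg = v &
     #|nbhd G v :&: Uset h| = rg h' rBest).
Proof.
rewrite /find_best run_seq; set h0 := run _ h; set body := _ ;; _.
pose I i h' := [/\ ar h' = ar h,
  forall v : 'I_n, v < i -> #|nbhd G v :&: Uset h| <= rg h' rBest &
  rg h' rBest != 0 -> exists2 v : 'I_n, rg h' rArg = v &
     #|nbhd G v :&: Uset h| = rg h' rBest].
have [||h1 [_ b1 a1] ->] := @for_inv n (adj G) I rV body h0; first by [].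
- move=> i h1 ilt [ar1 b1 a1]; pose o := Ordinal ilt.
  rewrite /body run_seq (countP (P := fun x => G o x && (ar h aU x != 0))); last first.
    move=> x k; rewrite heval_and -(adjE G o x) -ar1.
    by rewrite /= /upd /= eqb0 negbK.
  have -> : [set x | G o x && (ar h aU x != 0)] = nbhd G o :&: Uset h.
    by apply/setP => x; rewrite !inE.
  set g := #|_|; rewrite run_when [heval _ _ _ _]/= /upd [_ - _]/=.
  have lt (v : 'I_n) : v < i.+1 -> v = o \/ v < i.
    rewrite ltnS leq_eqVlt => /orP[/eqP e|]; last by right.
    by left; apply: val_inj.
  case: ifPn => c; split=> //=.
  + move=> v /lt[->|/b1 le]; rewrite /upd /=; first by rewrite -/g.
    by apply: leq_trans le _; move: c; rewrite subn_eq0 -ltnNge; exact: ltnW.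
  + by move=> _; exists o.
  + move=> v /lt[->|/b1 //]; rewrite /upd /= -/g.
    by move: c; rewrite negbK subn_eq0.
- by split=> // v; apply: b1.
Qed.

Lemma coverP h (v : 'I_n) : rg h rArg = v -> Uset (run cover h) = Uset h :\: nbhd G v.
Proof.
move=> hv; rewrite /cover; set body := CWhen _ _.
pose I i h' := rg h' rArg = v /\ forall x : 'I_n,
  (ar h' aU x != 0) = (ar h aU x != 0) && ~~ ((x < i) && G v x).
have [||h1 [_ c1] ->] := @for_inv n (adj G) I rX body h.
- by split=> // x; rewrite andbT.
- move=> i h1 ilt [v1 c1]; pose o := Ordinal ilt.
  split; first by rewrite frame_rg.
  move=> x; rewrite /body run_when.
  have -> : heval n (adj G) (setr h1 rX i) (HE rArg rX) = G v o.
    by rewrite /= /upd /= v1 -[X in adj G _ X]/(nat_of_ord o) adjE.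
  rewrite eqb0 negbK ltnS leq_eqVlt; case: ifPn => vo /=; last first.
    by rewrite c1; case: (x =P i :> nat) => //= xi; have -> : x = o; [apply: val_inj | rewrite (negbTE vo) !andbF].
  rewrite /upd /=; case: (x =P i :> nat) => [xi|_]; last by rewrite c1.
  by have -> : x = o; [apply: val_inj | rewrite vo andbF].
- by apply/setP => x; rewrite !inE /= c1 ltn_ord andbC.
Qed.

Lemma greedy_stepP h : let h' := run greedy_step h in
  exists2 b, forall v, #|nbhd G v :&: Uset h| <= b &
  if b == 0 then [/\ Uset h' = Uset h, Dset h' = Dset h & rg h' rSize = rg h rSize]
  else exists v, [/\ #|nbhd G v :&: Uset h| = b, Uset h' = Uset h :\: nbhd G v,
    Dset h' = v |: Dset h & rg h' rSize = (rg h rSize).+1].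
Proof.
rewrite /greedy_step run_seq; have [] := find_bestP h; set h1 := run find_best h => b1 a1.
exists (rg h1 rBest) => //.
have U1 : Uset h1 = Uset h by apply/setP => x; rewrite !inE frame_ar.
have D1 : Dset h1 = Dset h by apply/setP => x; rewrite !inE /inD frame_ar.
have S1 : rg h1 rSize = rg h rSize by rewrite frame_rg.
rewrite run_when -[heval _ _ _ _]/(rg h1 rBest).
rewrite !run_seq; set h2 := run (CSet _ _) _.
case: ifPn => [b0|nb]; first by rewrite b0.
rewrite ifT //; have [v av gv] := a1 nb; exists v.
split=> //.
- by rewrite (@coverP _ v) // -U1; congr (_ :\: _); apply/setP => x; rewrite !inE.
- apply/setP => x; rewrite -D1 !inE /inD frame_ar //= /upd av val_eqE.
  by case: (x == v).
- by rewrite frame_rg //= /upd /= S1 addn1.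
Qed.

(* Size plus number of uncovered vertices never increases, so the final size is
   at most [j] plus the number of vertices uncovered after [j] steps. *)
Lemma greedyP h : 0 < n -> 0 < min_degree G -> let h' := run greedy h in
  [/\ #|Dset h'| <= rg h' rSize, dominating G (inD h') &
      forall j, j <= n -> (rg h' rSize - j) * n ^ j <= n * (n - min_degree G) ^ j].
Proof.
set d := min_degree G => n0 d0.
rewrite /greedy !run_seq; set h1 := run (CFor rX _) h; set h0 := run (CSet rSize _) h1.
have [D0 U0] : Dset h0 = finset.set0 /\ Uset h0 = [set: 'I_n].
  have -> : Dset h0 = Dset h1 by [].
  have -> : Uset h0 = Uset h1 by [].
  rewrite /h1; set body := _ ;; _.
  pose I i h' := forall x : 'I_n, x < i -> ar h' aD x = 0 /\ ar h' aU x = 1.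
  have [||h2 c2 ->] := @for_inv n (adj G) I rX body h; first by [].
    move=> i h2 ilt c2 x; rewrite ltnS leq_eqVlt /= /upd /=.
    by case: eqP => //= _; exact: c2.
  by split; apply/setP => x; rewrite !inE /inD /=; have [a u] := c2 x (ltn_ord x); rewrite ?a ?u.
have S0 : rg h0 rSize = 0 by [].
clearbody h0.
(* The bound [n - i] makes [n] steps enough to cover everything; the geometric bound supplies the
   case of [j] equal to the current step. *)
pose I i h' := [/\ #|Dset h'| <= rg h' rSize, rg h' rSize <= i &
   [/\ #|Uset h'| <= n - i, #|Uset h'| * n ^ i <= n * (n - d) ^ i,
   forall j, j <= i -> (rg h' rSize + #|Uset h'| - j) * n ^ j <= n * (n - d) ^ j &
   forall x, x \notin Uset h' -> exists2 y, inD h' y & G y x]].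
have [||h2 [D2 _ [U2 _ j2 dom2]] ->] := @for_inv n (adj G) I rI greedy_step h0.
- split; rewrite ?D0 ?U0 ?S0 ?cards0 // cardsT card_ord; split; rewrite ?subn0 ?expn0 //.
    by move=> j; rewrite leqn0 => /eqP ->; rewrite subn0.
  by move=> x; rewrite inE.
- move=> i h2 ilt [D2 s2 [U2 p2 j2 dom2]]; set h3 := setr h2 rI i.
  have := greedy_stepP h3; rewrite -/(Uset h3) -/(Dset h3).
  have -> : Uset h3 = Uset h2 by [].
  have -> : Dset h3 = Dset h2 by [].
  have -> : rg h3 rSize = rg h2 rSize by [].
  set h4 := run _ h3 => -[b gain].
  have dn : d <= n.
    have := min_degree_le G (Ordinal n0); move/leq_trans; apply.
    by rewrite -[leqRHS]card_ord max_card.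
  (* The best vertex covers at least the fraction [d / n] of what is left; in particular a gain of 0
     means that nothing is left. *)
  have key : #|Uset h2| * d <= n * b.
    by have := greedy_gain (min_degree_le G) gain; rewrite card_ord.
  case: ifPn => [/eqP b0 [U4 D4 s4]|b0 [v [gv U4 D4 s4]]].
    have U2' : #|Uset h2| = 0 by move: key; rewrite b0 muln0 leqn0 muln_eq0 (gtn_eqF d0) orbF => /eqP.
    split; rewrite ?U4 ?D4 ?s4 ?U2' //; first exact: leqW.
    have inD4 y : inD h4 y = inD h2 y by move/setP/(_ y): D4; rewrite !inE.
    split=> // [j|x /dom2[y Dy yx]]; last by exists y; rewrite // inD4.
    rewrite leq_eqVlt => /orP[/eqP ->|ji]; last by have := j2 j ji; rewrite U2'.
    by rewrite addn0 (eqP (_ : rg h2 rSize - i.+1 == 0)) // subn_eq0 leqW.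
  have cU : #|Uset h4| + b = #|Uset h2|.
    by rewrite U4 -(cardsID (nbhd G v) (Uset h2)) [_ :&: nbhd G v]finset.setIC gv addnC.
  have b1 : 0 < b by rewrite lt0n.
  have inD4 y : inD h4 y = (y == v) || inD h2 y by move/setP/(_ y): D4; rewrite !inE.
  (* One step shrinks the uncovered set by the factor [(n - d) / n], written without division. *)
  have p4 : #|Uset h4| * n ^ i.+1 <= n * (n - d) ^ i.+1.
    have q : #|Uset h4| * n <= #|Uset h2| * (n - d) by nia.
    rewrite !expnS mulnA; apply: leq_trans (leq_mul q (leqnn _)) _.
    have := leq_mul (leqnn (n - d)) p2.
    by rewrite mulnCA mulnA [X in _ <= X -> _]mulnCA.
  split.
  + by rewrite D4 s4 (leq_trans (leq_card_setU _ _)) // cards1 add1n.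
  + by rewrite s4.
  + split=> //; first by lia.
    * move=> j; rewrite leq_eqVlt => /orP[/eqP ->|ji].
        by apply: leq_trans p4; rewrite leq_mul2r s4; apply/orP; right; lia.
      apply: leq_trans (j2 j ji); rewrite leq_mul2r s4; apply/orP; right; lia.
    * move=> x; rewrite U4 inE negb_and negbK => /orP[vx|/dom2[y Dy yx]].
        by exists v; [rewrite inD4 eqxx | rewrite inE in vx].
      by exists y; rewrite // inD4 Dy orbT.
- have U2' : Uset h2 = finset.set0 by apply/cards0_eq/eqP; move: U2; rewrite subnn leqn0.
  split=> //.
  + by move=> x; right; apply: dom2; rewrite U2' inE.
  + by move=> j jn; have := j2 j jn; rewrite U2' cards0 addn0.
Qed.

Lemma copy_rowP h (v : 'I_n) : rg h rV = v -> Dset (run copy_row h) = nbhd G v.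
Proof.
move=> hv; rewrite /copy_row; set body := CPut _ _ _.
pose I i h' := rg h' rV = v /\ forall x : 'I_n, x < i -> ar h' aD x = G v x.
have [||h1 [_ c1] ->] := @for_inv n (adj G) I rX body h; first by [].
- move=> i h1 ilt [v1 c1]; pose o := Ordinal ilt; split=> // x.
  rewrite ltnS leq_eqVlt /= /upd /=; case: (x =P i :> nat) => [xi _|_]; last exact: c1.
  have -> : x = o by apply: val_inj.
  by rewrite v1 -[X in adj G _ X]/(nat_of_ord o) adjE.
- by apply/setP => x; rewrite !inE /inD /= c1 // eqb0 negbK.
Qed.

(** The vertex [v] is not in its own neighborhood, but is covered by any of its neighbors, and one
    exists as degrees are positive. *)
Lemma dominating_row (v : 'I_n) : is_diam G 2 -> 0 < min_degree G -> dominating G (G v).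
Proof.
move=> diam d0 x; have [->|vx] := eqVneq x v; last first.
  by rewrite eq_sym in vx; exact: diam2_walk.
have /card_gt0P[y] := leq_trans d0 (min_degree_le G v).
by rewrite inE => vy; right; exists y; rewrite // edge_sym.
Qed.

(** Every neighborhood dominates, so replacing the set by a smaller one keeps the invariant; a
    vertex of minimum degree gives the last bound. *)
Lemma smallestP h : is_diam G 2 -> 0 < min_degree G ->
  #|Dset h| <= rg h rSize -> dominating G (inD h) -> let h' := run smallest h in
  [/\ #|Dset h'| <= rg h' rSize, dominating G (inD h'), rg h' rSize <= rg h rSize
    & rg h' rSize <= min_degree G].
Proof.
move=> diam d0 D0 dom0; rewrite /smallest; set body := _ ;; _.
pose I i h' := [/\ #|Dset h'| <= rg h' rSize, dominating G (inD h'), rg h' rSize <= rg h rSize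
    & forall v : 'I_n, v < i -> rg h' rSize <= #|nbhd G v|].
have [||h1 [D1 dom1 s1 m1] ->] := @for_inv n (adj G) I rV body h; first by [].
- move=> i h1 ilt [D1 dom1 s1 m1]; pose o := Ordinal ilt.
  rewrite /body run_seq (countP (P := G o)); last first.
    by move=> x k; rewrite /= /upd /= eqb0 negbK -(adjE G o x).
  rewrite -[#|_|]/(#|nbhd G o|); set g := #|_|; set h2 := setr _ _ _.
  have lt (v : 'I_n) : v < i.+1 -> v = o \/ v < i.
    rewrite ltnS leq_eqVlt => /orP[/eqP e|]; last by right.
    by left; apply: val_inj.
  rewrite run_when -[heval _ _ _ _]/(rg h1 rSize - g); case: ifPn => c; last first.
    split=> // v /lt[->|]; last exact: m1.
    by rewrite -subn_eq0; move: c; rewrite negbK.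
  have gs : g < rg h1 rSize by move: c; rewrite subn_eq0 -ltnNge.
  rewrite run_seq; set h3 := run (CSet _ _) h2.
  have D4 : Dset (run copy_row h3) = nbhd G o by rewrite (@copy_rowP _ o).
  have s4 : rg (run copy_row h3) rSize = g by rewrite frame_rg.
  split.
  + by rewrite D4 s4.
  + have -> : inD (run copy_row h3) = G o; last exact: dominating_row.
    by apply/boolp.funext => x; move/setP/(_ x): D4; rewrite !inE.
  + by rewrite s4 (leq_trans (ltnW gs)).
  + by move=> v; rewrite s4 => /lt[->|/m1] //; apply: leq_trans; exact: ltnW.
- split=> //; have n0 : 0 < #|'I_n| by apply: ltn_trans (diam2_card diam).
  have [v] := min_degree_attained G n0.
  exact: leq_trans (m1 v (ltn_ord v)).
Qed.

(** * The complete solver *)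

Definition prepare : cmd := greedy ;; smallest ;; powers ;; CSet rAns (HC 0).

Lemma prepareP h : irreducible G -> is_diam G 2 -> let h' := run prepare h in
  exists k, [/\ rg h' rM <= 3 ^ k, k <= min_degree G,
    forall j, j <= n -> (k - j) * n ^ j <= n * (n - min_degree G) ^ j
  & [/\ dominating G (inD h'), pow_table h', rg h' rAns = 0 & rg h' rM = 3 ^ rank (inD h') n]].
Proof.
move=> irr diam; have d2 := irreducible_min_degree irr diam.
have n3 : 2 < n by rewrite -[X in 2 < X]card_ord (diam2_card diam).
have d0 : 0 < min_degree G by apply: ltnW.
rewrite /prepare !run_seq; have [] := greedyP h (ltn_trans (isT : 0 < 2) n3) d0.
set h1 := run greedy h => D1 dom1 b1.
have [] := smallestP diam d0 D1 dom1; set h2 := run smallest h1 => D2 dom2 s2 m2.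
have [] := powersP h2; set h3 := run powers h2 => pow3 M3.
have inD3 : inD h3 = inD h2 by apply/boolp.funext => x; rewrite /inD frame_ar.
have R : rank (inD h2) n = #|Dset h2| by rewrite rankn.
exists (rg h2 rSize); split=> //.
- by rewrite -[rg _ _]/(rg h3 rM) M3 R leq_pexp2l.
- by move=> j jn; apply: leq_trans (b1 j jn); rewrite leq_mul2r leq_sub2r ?orbT.
- by split=> //; rewrite -?[inD _]/(inD h3) ?inD3.
Qed.

End SearchProgram.

Lemma solverP n (G : graph 'I_n) : irreducible G -> is_diam G 2 ->
  exists t s' k, [/\ exec (search prepare try_next rM rAns) (input G) t s',
    reg s' 0 != 0 <-> three_colorable G,
    t <= n ^ (deg prepare + deg try_next + 10) * (3 ^ k).+1, k <= min_degree G
    & forall j, j <= n -> (k - j) * n ^ j <= n * (n - min_degree G) ^ j].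
Proof.
move=> irr diam; have n3 : 2 < n by rewrite -[X in 2 < X]card_ord (diam2_card diam).
(* All codes from [m] on have been tried: initially vacuous, as codes stay below the starting value
   of [rM], and covering every coloring at [m = 0]. *)
pose J m h := [/\ dominating G (inD h), pow_table n h,
  rg h rAns != 0 -> three_colorable G &
  forall f : 'I_n -> 'I_3, (forall u v, G u v -> f u != f v) -> m <= code (inD h) f n -> rg h rAns != 0].
have [|//|//|//||||t [s' [h [e a l]]]] := @searchP prepare try_next rM rAns n G (three_colorable G) J.
- exact: ltnW.
- move=> h; have [k [_ _ _ [dom pow ans M]]] := prepareP h irr diam.
  split=> //.
  by move=> f _; rewrite M leqNgt code_lt.
- move=> m h [dom pow sound complete] hM; set h1 := setr h rM m.
  have [b1 b2 b3] := @try_nextP n G h1 n3 dom pow.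
  have D2 : inD (n := n) (den n (adj G) try_next h1) = inD h by apply/boolp.funext => x; rewrite /inD frame_ar.
  split.
  + by rewrite D2.
  + by move=> v; rewrite D2 frame_ar //; exact: pow.
  + by move/b1 => [/sound|].
  + move=> f fP; rewrite D2 leq_eqVlt => /orP[/eqP mf|mf]; first exact: b3 fP mf.
    by apply: b2; exact: complete fP mf.
- move=> h [_ _ sound complete]; split=> // -[f fP]; exact: complete fP _.
- have [k [M k1 k2 _]] := prepareP h irr diam.
  exists t, s', k; split=> //; apply: leq_trans l _.
  by rewrite leq_mul2l ltnS M orbT.
Qed.

(** * The running time *)

Import GRing.Theory Num.Theory Order.TTheory.
Local Open Scope ring_scope.

(** Let [X = (n / d) ln d] and let [j] be its integer part plus 1. Then [(1 - d / n) ^ j <= exp (- j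
    d / n) <= 1 / d], so [k <= j + n / d <= X + 1 + n / d]. As [1 <= n / d <= 2 X], this is at most
    [5 X]. *)
Lemma greedy_size_bound (R : realType) (n d k : nat) :
  (2 <= d)%N -> (d <= n)%N -> (k <= d)%N ->
  (forall j, (j <= n)%N -> ((k - j) * n ^ j <= n * (n - d) ^ j)%N) ->
  k%:R <= 5 * Num.min (d%:R : R) (n%:R / d%:R * ln d%:R).
Proof.
move=> d2 dn kd H.
have d0 : (0 : R) < d%:R by rewrite ltr0n; lia.
have n0 : (0 : R) < n%:R by rewrite ltr0n; lia.
have d2R : (2 : R) <= d%:R by rewrite ler_nat.
set X : R := n%:R / d%:R * ln d%:R.
rewrite -[5 * _]mulrC minr_pMl // le_min; apply/andP; split.
  have : (k%:R : R) <= d%:R by rewrite ler_nat.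
  by lra.
(* From [ln (1 + x) <= x] at [x = 1 / d - 1], which is at most [- 1 / 2]. *)
have ln2 : (1 / 2 : R) <= ln d%:R.
  have dV : (d%:R^-1 : R) <= 2^-1 by rewrite lef_pV2 ?posrE.
  have dV0 : 0 < (d%:R^-1 : R) by rewrite invr_gt0.
  have := @le_ln1Dx R (d%:R^-1 - 1); rewrite (addrC 1) subrK lnV ?posrE //.
  have -> : -1 < (d%:R^-1 - 1 : R) by lra.
  by move=> /(_ isT); lra.
have X0 : 0 <= X by rewrite /X mulr_ge0 ?divr_ge0 ?(ltW d0) ?(ltW n0) //; lra.
have nd1 : (1 : R) <= n%:R / d%:R by rewrite ler_pdivlMr // mul1r ler_nat.
have X2 : n%:R / d%:R <= 2 * X by rewrite /X; nra.
pose j := (Num.truncn X).+1.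
have [jl ju] : (Num.truncn X)%:R <= X /\ X < j%:R.
  by have /andP := truncn_itv X0.
have lnd : ln (d%:R : R) <= d%:R - 1.
  have := @le_ln1Dx R (d%:R - 1); rewrite (addrC 1) subrK; apply; lra.
(* The greedy bound is available only up to [j = n]; [ln d <= d - 1] gives [X < n]. *)
have jn : (j <= n)%N.
  rewrite /j -(ltr_nat R); apply: le_lt_trans jl _.
  rewrite /X -mulrA gtr_pMr // mulrC ltr_pdivrMr //; lra.
have := H j jn; rewrite -(ler_nat R) !natrM !natrX (natrB _ dn) => Hj.
have kj : (k%:R : R) <= j%:R + (k - j)%:R by rewrite -natrD ler_nat; lia.
have p : ((n%:R - d%:R) / n%:R) ^+ j <= (d%:R)^-1 :> R.
  have -> : (n%:R - d%:R) / n%:R = 1 + (- (d%:R / n%:R)) :> R.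
    by rewrite mulrBl divff ?gt_eqF.
  apply: le_trans (_ : expR (- (d%:R / n%:R)) ^+ j <= _).
    apply: lerXn2r; rewrite ?nnegrE ?expR_ge0 ?expR_ge1Dx //.
    by rewrite subr_ge0 ler_pdivrMr // mul1r ler_nat.
  rewrite -expRM_natl -[leRHS]lnK ?posrE ?invr_gt0 // ler_expR lnV ?posrE // mulrN lerN2.
  have : X * (d%:R / n%:R) <= j%:R * (d%:R / n%:R).
    by apply: ler_wpM2r; [rewrite divr_ge0 // ltW | exact: ltW].
  apply: le_trans; rewrite le_eqVlt; apply/orP; left; apply/eqP.
  by rewrite /X; field; rewrite !gt_eqF.
have kj2 : (k - j)%:R <= n%:R / d%:R :> R.
  have nj : (0 : R) < n%:R ^+ j by rewrite exprn_gt0.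
  move: Hj; rewrite -ler_pdivlMr // -mulrA -expr_div_n => Hj.
  by apply: le_trans Hj _; rewrite ler_pM2l.
have jX : (j%:R : R) <= X + 1 by rewrite /j -natr1; lra.
lra.
Qed.

Theorem theorem1 (R : realType) :
  exists (A : prog) (c : R) (k : nat),
    0 < c /\
    forall (n : nat) (G : graph 'I_n),
      irreducible G ->
      is_diam G 2 ->
      let delta : R := (min_degree G)%:R in
      decides_within A (input G) (three_colorable G)
        (n%:R ^+ k *
         2 `^ (c * Num.min delta (n%:R / delta * ln delta))).
Proof.
(* The constant is [10 = 2 * 5]: [3 ^ k + 1 <= 2 * 2 ^ (2 * k)] with [k] at most 5 times the
   minimum. The additional power of [n] absorbs the factor 2. *)
exists (search prepare try_next rM rAns), 10, (deg prepare + deg try_next + 10).+1%N.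
split=> // n G irr diam delta.
have n3 : (2 < n)%N by rewrite -[X in (2 < X)%N]card_ord (diam2_card diam).
have [t [s' [k [e a l kd kb]]]] := solverP irr diam.
exists t, s'; split=> //.
have d2 := irreducible_min_degree irr diam.
have dn : (min_degree G <= n)%N.
  have [v _] := min_degree_attained G (ltn_trans (isT : 0 < 2)%N (diam2_card diam)).
  by rewrite -[X in (_ <= X)%N]card_ord (leq_trans (min_degree_le G v)) // max_card.
have bound := greedy_size_bound R d2 dn kd kb.
have tl : (t <= n ^ (deg prepare + deg try_next + 10).+1 * 2 ^ (2 * k))%N.
  apply: leq_trans l _; rewrite expnSr -mulnA leq_mul2l; apply/orP; right.
  apply: (@leq_trans (2 * 4 ^ k)); last by rewrite (expnM 2 2) leq_mul2r (ltnW n3) orbT.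
  have : (3 ^ k <= 4 ^ k)%N by case: (k) => [|k1] //; rewrite leq_exp2r.
  have : (0 < 4 ^ k)%N by rewrite expn_gt0.
  lia.
apply: (@le_trans _ _ (n ^ (deg prepare + deg try_next + 10).+1 * 2 ^ (2 * k))%:R).
  by rewrite ler_nat.
rewrite natrM !natrX ler_wpM2l ?exprn_ge0 ?ler0n //.
rewrite -powR_mulrn // ler_powR ?ler1n // natrM.
apply: le_trans (ler_wpM2l _ bound) _; first exact: ler0n.
by rewrite mulrA -natrM.
Qed.
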